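(* Let $\nu$ be the middle-thirds Cantor measure affinely rescaled to $[0.5,2.0]$ and let $L(s)=\sum_{n\ge1}\hat\nu(n)n^{-s}$, continued to an entire function. For every $A>0$, the exceptional set $$\mathcal{E}_A(T):=\bigl\{t\in[T,2T]:|L(\tfrac12+it)|>(\log t)^A\bigr\}$$ has Lebesgue measure $|\mathcal{E}_A(T)|\ll_A T/(\log T)^{4A-3}$. In particular, for every $A>\tfrac34$, $|L(\tfrac12+it)|\le(\log t)^A$ holds for all $t$ outside a set of logarithmic density zero.
   Context: $\nu$ is the probability measure on $[0.5,2.0]\subset(0,2\pi)$ obtained from the middle-thirds Cantor measure by an affine map; $\hat\nu(n)=\int e^{in\theta}\,d\nu(\theta)$. The entire continuation is $L(s)=\int F(\theta,s)\,d\nu(\theta)$ with $F(\theta,s)=\sum_{n\ge1}e^{in\theta}n^{-s}$ (continued analytically). *)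

(* Defs.v *)
From HB Require Import structures.
From mathcomp Require Import all_boot all_order all_algebra archimedean.
From mathcomp Require Import complex.
From mathcomp Require Import all_classical all_reals all_analysis measurable_realfun.
From mathcomp Require Import lra.

Set Implicit Arguments.
Unset Strict Implicit.
Unset Printing Implicit Defensive.

Import Order.TTheory GRing.Theory Num.Theory.
Import numFieldNormedType.Exports.

Local Open Scope classical_set_scope.
Local Open Scope ring_scope.
Local Open Scope complex_scope.

Section cantor_measure.
Context {R : realType}.
Implicit Types (x : R) (n : nat).

(* The digit of weight 2 ^- n.+1 in the binary expansion of x. *)
Definition binary_digit n x : R :=
  (Num.floor (2 ^+ n.+1 * x))%:~R - 2 * (Num.floor (2 ^+ n * x))%:~R.

Lemma binary_digit_ge0 n x : 0 <= binary_digit n x.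
Proof.
rewrite /binary_digit subr_ge0 exprS -mulrA.
set y := 2 ^+ n * x.
rewrite -(intrM R 2) ler_int floor_ge_int intrM.
by rewrite ler_wpM2l// floor_le.
Qed.

Lemma binary_digit_le1 n x : binary_digit n x <= 1.
Proof.
rewrite /binary_digit lerBlDr exprS -mulrA.
set y := 2 ^+ n * x.
rewrite -(intrM R 2) -(intrD R 1) ler_int -ltzD1 -(ltr_int R).
have := floorD1_gt y; have := floor_le (2 * y).
rewrite !intrD intrM /=; lra.
Qed.

Lemma measurable_binary_digit n : measurable_fun [set: R] (binary_digit n).
Proof.
have mf k : measurable_fun [set: R] (fun x => (Num.floor (2 ^+ k * x))%:~R : R).
  apply: nondecreasing_measurable => // x y xy.
  by rewrite ler_int le_floor// ler_wpM2l.
by apply: measurable_funB => //; apply: measurable_funM.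
Qed.

(* 0.b_0 b_1 b_2 ... in base two is sent to 0.(2 b_0)(2 b_1)(2 b_2) ... in
   base three, so a uniform point of [0, 1] is sent to a point of the
   middle-thirds Cantor set with independent, fair ternary digits 0 and 2. *)
Definition cantor_map : measurableTypeR R -> measurableTypeR R := fun x =>
  limn (series (fun n => 2 * binary_digit n x / 3 ^+ n.+1)).

Lemma is_cvg_cantor_map x :
  cvgn (series (fun n => 2 * binary_digit n x / 3 ^+ n.+1)).
Proof.
apply: (@series_le_cvg _ _ (geometric (2 / 3) 3^-1)).
- by move=> n; rewrite divr_ge0// mulr_ge0// binary_digit_ge0.
- by move=> n; rewrite /= mulr_ge0// exprn_ge0.
- move=> n; rewrite /= exprS invfM mulrA exprVn ler_wpM2r//.
  by rewrite ler_wpM2r// ler_piMr// binary_digit_le1.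
- by apply: is_cvg_geometric_series; rewrite ger0_norm//; lra.
Qed.

Lemma measurable_cantor_map : measurable_fun [set: R] cantor_map.
Proof.
apply: (@measurable_fun_cvg _ _ _ _
  (fun m x => series (fun n => 2 * binary_digit n x / 3 ^+ n.+1) m)).
- move=> m; rewrite /series /=.
  apply: measurable_sum => n.
  apply: measurable_funM => //; apply: measurable_funM => //.
  exact: measurable_binary_digit.
- by move=> x _; exact: is_cvg_cantor_map.
Qed.

HB.instance Definition _ :=
  @isMeasurableFun.Build _ _ _ _ cantor_map measurable_cantor_map.

Definition cantor_measure : probability (measurableTypeR R) R :=
  distribution (uniform_prob (@ltr01 R)) cantor_map.

(* The increasing affine map from [0, 1] onto [1/2, 2]. *)
Definition rescale : measurableTypeR R -> measurableTypeR R :=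
  fun x => 1 / 2 + 3 / 2 * x.

Lemma measurable_rescale : measurable_fun [set: R] rescale.
Proof. by apply: measurable_funD => //; exact: measurable_funM. Qed.

HB.instance Definition _ :=
  @isMeasurableFun.Build _ _ _ _ rescale measurable_rescale.

Definition nu : probability (measurableTypeR R) R :=
  distribution cantor_measure rescale.

Definition nu_hat n : R[i] :=
  (\int[nu]_theta cos (n%:R * theta)) +i* (\int[nu]_theta sin (n%:R * theta)).

End cantor_measure.

Section dirichlet.
Context {R : realType}.

Definition cexp (z : R[i]) : R[i] :=
  (expR (complex.Re z))%:C * (cos (complex.Im z) +i* sin (complex.Im z)).

Definition natpow (n : nat) (s : R[i]) : R[i] := cexp (s * (ln n%:R)%:C).

(* The domain and the codomain are the field R[i] seen as a normed space over
   itself, so this is complex differentiability at every point. *)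
Definition entire (f : R[i] -> R[i]) : Prop :=
  forall z : R[i], derivable (f : R[i]^o -> R[i]^o) z 1.

(* L is the entire continuation of sum_(n >= 1) a n / n ^ s, which is required
   to converge to L s when Re s > 1. By the identity theorem there is at most
   one such L. *)
Definition entire_continuation (a : nat -> R[i]) (L : R[i] -> R[i]) : Prop :=
  entire L /\
  forall s : R[i], 1 < complex.Re s ->
    (series (fun n => a n.+1 * natpow n.+1 (- s)) : nat -> R[i]^o) @ \oo
      --> (L s : R[i]^o).

(* The norm of R[i] takes its values in R[i]. *)
Definition cabs (z : R[i]) : R := complex.Re `|z|.

Definition exceptional_set (L : R[i] -> R[i]) (A T : R) : set R :=
  [set t | T <= t <= 2 * T /\ ln t `^ A < cabs (L ((1 / 2) +i* t))].

(* The density of S with respect to dt / t, for S restricted to t >= 1. *)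
Definition has_log_density (S : set R) (d : R) : Prop :=
  measurable S /\
  (\int[lebesgue_measure]_(t in S `&` `[1, X]) t^-1) / ln X @[X --> +oo] --> d.

End dirichlet.

(* Main.v *)
Require Import Defs.
From mathcomp Require Import all_boot all_order all_algebra.
From mathcomp Require Import complex.
From mathcomp Require Import all_classical all_reals all_analysis measurable_realfun.
From mathcomp Require Import ring lra zify.

Set Implicit Arguments.
Unset Strict Implicit.
Unset Printing Implicit Defensive.

Import Order.TTheory GRing.Theory Num.Theory.
Import numFieldNormedType.Exports.
Local Open Scope classical_set_scope.
Local Open Scope ring_scope.

(** The Cantor measure has dimension log 2 / log 3 > 1/2, so in mean square its
Fourier coefficients decay faster than n ^ (-1/2): the sum of |nu_hat n| ^ 2
over n < 3 ^ k is O(q ^ (2 k)) with q = 13/10 ([nu_hat_mean_square]).  This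
follows from the self-similarity of the measure, which bounds |nu_hat n| ^ 2 by
the k-fold product of the (1 + cos (n / 3 ^ j)) / 2, that is by the squared
modulus of an exponential sum over the 2 ^ k integers whose ternary digits are
0 and 1.  What matters about q is that 3/2 < q ^ 2 and q ^ 4 < 3.

Continuation.  One has nu_hat n = E e^{i n theta} with theta in [1/2, 2], where
1 - e^{i theta} stays away from 0.  Hence b_k(n) = E e^{i n theta} (1 - e^{i
theta})^{-k} is bounded in n, and b_{k+1}(n) - b_{k+1}(n+1) = b_k(n).  Summing by
parts k times replaces the series by one over the k-th differences of n ^ (-s),
which are O(n ^ (- Re s - k)).  These series converge for Re s > 1 - k and agree
with each other, so they glue to an entire function ([abel_entire_continuation]);
the first summation by parts also shows that for t in [T, 2T] the partial sum up
to 3 ^ M, with T ^ 2 <= 3 ^ M, is within O(1) of L(1/2 + it)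
([nu_zeta_partial_sum]).

Large values.  Cut that partial sum at 3 ^ K.  By Cauchy-Schwarz the part n < 3 ^ K
is O(q ^ K) for every t.  The mean square over [T, 2T] of the other part has a
diagonal contribution O(T q ^ (- 2 K)) and an off-diagonal one O(M q ^ (2 M)); as
3 ^ M is of size T ^ 2 and q ^ 4 < 3, the latter is O(T ^ (1 - c)) for some c > 0.
Taking q ^ K of size (ln T) ^ A, Chebyshev's inequality bounds the measure of the
exceptional set by O(T / (ln T) ^ (4 A)) ([exceptional_measure_le]), which is
stronger than the claim by the factor (ln T) ^ 3.

Logarithmic density.  The set where |L(1/2 + it)| > (ln t) ^ A meets [2 ^ j, 2 ^ (j+1)]
in a set of dt / t measure O(j ^ (- 4 A)).  For A > 3/4 this is summable, so the
whole set has finite dt / t measure, a fortiori logarithmic density zero. *)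

(** * Expectations over a uniform variable *)
Section affine.
Context {R : realType}.
Local Notation mu := (@lebesgue_measure R).

Definition affine (a b : R) : measurableTypeR R -> measurableTypeR R :=
  fun x => a * x + b.

Lemma measurable_affine a b : measurable_fun [set: measurableTypeR R] (affine a b).
Proof. by apply: measurable_funD => //; exact: measurable_funM. Qed.

(** The scaled image is packed as a measure so that the uniqueness of Lebesgue
measure applies to it. *)
Lemma affine_measure (a b : R) (a0 : 0 <= a) :
  exists m : {measure set (measurableTypeR R) -> \bar R},
    forall A, m A = (a%:E * pushforward mu (affine a b) A)%E.
Proof.
have ma := measurable_affine a b.
by unshelve eexists (mscale (NngNum a0) (pushforward mu (affine a b))) => //.
Qed.

Lemma lebesgue_measure_affine (a b : R) (A : set (measurableTypeR R)) :
  0 < a -> measurable A ->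
  (mu A = a%:E * pushforward mu (affine a b) A)%E.
Proof.
move=> a0 mA.
have [m mE] := affine_measure b (ltW a0).
rewrite -mE; apply: lebesgue_measure_unique => //= _ [[u v]] _ <-.
rewrite mE /pushforward.
rewrite (_ : _ @^-1` _ = `](u - b) / a, (v - b) / a]%classic); last first.
  apply/seteqP; split => x /=; rewrite !in_itv/= /affine ltr_pdivrMr// ler_pdivlMr//;
   by rewrite ltrBlDr lerBrDr [x * a]mulrC.
rewrite !lebesgue_measure_itv/= !lte_fin.
rewrite ltr_pM2r ?invr_gt0// ltrD2r; case: ifP => uv; last by rewrite mule0.
rewrite -!EFinB -EFinM; congr EFin.
by field; lra.
Qed.

(** The integrand is only measurable: the Cantor map, to which this change of
variables is applied, is discontinuous at the dyadic points. *)
Lemma ge0_integral_affine (a b : R) (D : set (measurableTypeR R))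
    (f : measurableTypeR R -> \bar R) : 0 < a ->
  measurable D -> measurable_fun [set: measurableTypeR R] f -> (forall x, 0 <= f x)%E ->
  (\int[mu]_(x in D) f x =
   a%:E * \int[mu]_(x in affine a b @^-1` D) f (a * x + b)%R)%E.
Proof.
move=> a0 mD mf f0.
have ma := measurable_affine a b.
have mfD : measurable_fun D f by exact: measurable_funS mf.
transitivity (a%:E * \int[pushforward mu (affine a b)]_(y in D) f y)%E; last first.
  congr (_ * _)%E.
  by refine (@ge0_integral_pushforward _ _ (measurableTypeR R)
    (measurableTypeR R) R (affine a b) ma mu D f mD mfD _).
rewrite -(@ge0_integral_mscale _ _ _ (pushforward mu (affine a b)) _ mD
  (NngNum (ltW a0)))//.
apply: eq_measure_integral => A mA _.
exact: lebesgue_measure_affine.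
Qed.

End affine.

Section uniform_halves.
Context {R : realType}.
Local Notation mu := (@lebesgue_measure R).
Local Notation P := (uniform_prob (@ltr01 R)).

Lemma ge0_integral_uniform01_split (f : measurableTypeR R -> \bar R) :
  measurable_fun [set: measurableTypeR R] f -> (forall x, 0 <= f x)%E ->
  (\int[P]_x f x = 2^-1%:E * \int[P]_x f (2^-1 * x)%R
                 + 2^-1%:E * \int[P]_x f (2^-1 * x + 2^-1)%R)%E.
Proof.
move=> mf f0.
have mfa a b : measurable_fun [set: measurableTypeR R]
    (fun x : measurableTypeR R => f (a * x + b)).
  by apply: (measurableT_comp mf); exact: measurable_affine.
have mf1 : measurable_fun [set: measurableTypeR R] (fun x : measurableTypeR R => f (2^-1 * x)).
  by have := mfa 2^-1 0; under eq_fun do rewrite addr0.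
rewrite !integral_uniform//.
rewrite subr0 invr1 !mul1e.
rewrite (_ : `[0, 1]%classic = `[0, 2^-1]%classic `|` `]2^-1, 1]%classic); last first.
  by rewrite -itv_bndbnd_setU// bnd_simp; lra.
rewrite ge0_integral_setU //=; last 2 first.
  exact: measurable_funS mf.
  apply/disj_setPS => y [/=]; rewrite !in_itv/= => ? ?; lra.
rewrite (@ge0_integral_affine _ 2^-1 0 `[0, 2^-1])//.
rewrite (@ge0_integral_affine _ 2^-1 2^-1 `]2^-1, 1])//.
congr (_ * _ + _ * _)%E.
  rewrite (_ : _ @^-1` _ = `[0, 2^-1]%classic `|` `]2^-1, 1]%classic).
    by apply: eq_integral => x _; rewrite addr0.
  rewrite -itv_bndbnd_setU ?bnd_simp; [|lra|lra].
  by apply/seteqP; split => x /=; rewrite !in_itv /affine /=; lra.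
rewrite (_ : _ @^-1` _ = `]0, 1]%classic); last first.
  by apply/seteqP; split => x /=; rewrite !in_itv /affine /=; lra.
rewrite integral_itv_obnd_cbnd; last exact: measurable_funS (mfa _ _).
by rewrite -itv_bndbnd_setU// bnd_simp; lra.
Qed.

End uniform_halves.

Section bounded_expectation.
Context {R : realType}.
Local Notation mu := (@lebesgue_measure R).
Local Notation P := (uniform_prob (@ltr01 R)).
Local Notation RR := (measurableTypeR R).
Implicit Types f g : RR -> R.

Definition bounded_mfun f :=
  measurable_fun [set: RR] f /\ exists M, forall x, `|f x| <= M.

Lemma bounded_mfun_integrable f :
  bounded_mfun f -> P.-integrable [set: RR] (EFin \o f).
Proof.
move=> [mf [M fM]]; apply: measurable_bounded_integrable => //.
  by have /= -> := @probability_setT _ _ _ P; rewrite ltry.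
by exists M; split; [exact: num_real|move=> y My x _; exact: le_trans (fM x) (ltW My)].
Qed.

Definition expect f : R := \int[P]_x f x.

Lemma expect_cst (c : R) : expect (fun=> c) = c.
Proof.
rewrite /expect Rintegral_cst//.
by have /= -> := @probability_setT _ _ _ P; rewrite mulr1.
Qed.

Lemma bounded_mfun_cst c : bounded_mfun (fun=> c).
Proof. by split=> //; exists `|c|. Qed.

Lemma bounded_mfunD f g : bounded_mfun f -> bounded_mfun g ->
  bounded_mfun (fun x => f x + g x).
Proof.
move=> [mf [M fM]] [mg [N gN]]; split; first exact: measurable_funD.
by exists (M + N) => x; rewrite (le_trans (ler_normD _ _))// lerD.
Qed.

Lemma bounded_mfunM f g : bounded_mfun f -> bounded_mfun g ->
  bounded_mfun (fun x => f x * g x).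
Proof.
move=> [mf [M fM]] [mg [N gN]]; split; first exact: measurable_funM.
by exists (M * N) => x; rewrite normrM ler_pM.
Qed.

Lemma bounded_mfunZ c f : bounded_mfun f -> bounded_mfun (fun x => c * f x).
Proof. exact/bounded_mfunM/bounded_mfun_cst. Qed.

Lemma bounded_mfunN f : bounded_mfun f -> bounded_mfun (fun x => - f x).
Proof. by under eq_fun do rewrite -mulN1r; exact: bounded_mfunZ. Qed.

Lemma bounded_mfunB f g : bounded_mfun f -> bounded_mfun g ->
  bounded_mfun (fun x => f x - g x).
Proof. by move=> bf bg; apply: bounded_mfunD => //; exact: bounded_mfunN. Qed.

Lemma expectD f g : bounded_mfun f -> bounded_mfun g ->
  expect (fun x => f x + g x) = expect f + expect g.
Proof. by move=> bf bg; rewrite /expect RintegralD//; exact: bounded_mfun_integrable. Qed.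

Lemma expectZ c f : bounded_mfun f -> expect (fun x => c * f x) = c * expect f.
Proof. by move=> bf; rewrite /expect RintegralZl//; exact: bounded_mfun_integrable. Qed.

Lemma expectB f g : bounded_mfun f -> bounded_mfun g ->
  expect (fun x => f x - g x) = expect f - expect g.
Proof.
move=> bf bg; rewrite expectD//; last exact: bounded_mfunN.
congr (_ + _); rewrite -[RHS]mulN1r -expectZ//.
by congr expect; apply/funext => x; rewrite mulN1r.
Qed.

Lemma le_expect f g : bounded_mfun f -> bounded_mfun g ->
  (forall x, f x <= g x) -> expect f <= expect g.
Proof.
by move=> bf bg fg; apply: le_Rintegral => //; exact: bounded_mfun_integrable.
Qed.

Lemma normr_expect_le f M : bounded_mfun f -> (forall x, `|f x| <= M) ->
  `|expect f| <= M.
Proof.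
move=> bf fM; rewrite ler_norml -{1}[- M]expect_cst -{2}[M]expect_cst.
by rewrite !le_expect//; try exact: bounded_mfun_cst;
  move=> x; have := fM x; rewrite ler_norml => /andP[].
Qed.

(* The integral lemmas above concern nonnegative functions. *)
Let expect_shift f M : bounded_mfun f -> (forall x, `|f x| <= M) ->
  expect f = fine (\int[P]_x (f x + M)%:E)%E - M.
Proof.
move=> bf fM; rewrite -[X in _ = X - _]/(expect (fun x => f x + M)).
by rewrite expectD ?expect_cst ?addrK//; exact: bounded_mfun_cst.
Qed.

(** The endpoint 1 carries no mass; the two halves of the Cantor map are affine
images of it only for 0 <= x < 1. *)
Lemma eq_expect01 f g : bounded_mfun f -> bounded_mfun g ->
  (forall x, 0 <= x < 1 -> f x = g x) -> expect f = expect g.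
Proof.
move=> bf bg fg; have [mf [M fM]] := bf; have [mg [N gN]] := bg.
have fMN x : `|f x| <= M + N.
  by rewrite (le_trans (fM x))// lerDl (le_trans _ (gN 0)).
have gMN x : `|g x| <= M + N.
  by rewrite (le_trans (gN x))// lerDr (le_trans _ (fM 0)).
rewrite (expect_shift bf fMN) (expect_shift bg gMN); congr (fine _ - _).
have mD (h : RR -> R) : measurable_fun [set: RR] h ->
    measurable_fun [set: RR] (fun x => (h x + (M + N))%:E).
  by move=> mh; apply/measurable_EFinP; exact: measurable_funD.
have ge0 (h : RR -> R) : (forall x, `|h x| <= M + N) ->
    forall x, (0 <= (h x + (M + N))%:E)%E.
  move=> hMN x; rewrite lee_fin; have := hMN x; rewrite ler_norml; lra.
rewrite !integral_uniform//; try exact: mD; try exact: ge0.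
rewrite -!integral_itv_bndo_bndc; try by apply: measurable_funTS; exact: mD.
congr (_ * _)%E; apply: eq_integral => x.
by rewrite inE/= in_itv/= => x01; rewrite fg.
Qed.

Lemma bounded_mfun_comp_affine f a b : bounded_mfun f ->
  bounded_mfun (fun x => f (a * x + b)).
Proof.
move=> [mf [M fM]]; split; last by exists M => x; exact: fM.
exact: (measurableT_comp mf (@measurable_affine R a b)).
Qed.

Lemma expect_halves f : bounded_mfun f ->
  expect f = 2^-1 * expect (fun x => f (2^-1 * x + 0))
           + 2^-1 * expect (fun x => f (2^-1 * x + 2^-1)).
Proof.
move=> bf; have [mf [M fM]] := bf.
have bfa b := @bounded_mfun_comp_affine f 2^-1 b bf.
have mfa b := (bfa b).1.
have fMa b x : `|f (2^-1 * x + b)| <= M by exact: fM.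
have ge0 x : (0 <= (f x + M)%:E)%E.
  by rewrite lee_fin; have := fM x; rewrite ler_norml; lra.
rewrite (expect_shift bf fM) (expect_shift (bfa _) (fMa 0)).
rewrite (expect_shift (bfa _) (fMa 2^-1)).
rewrite ge0_integral_uniform01_split//; last first.
  by apply/measurable_EFinP; exact: measurable_funD.
have fn b : (\int[P]_x (f (2^-1 * x + b) + M)%:E \is a fin_num)%E.
  apply: integrable_fin_num => //.
  by apply: bounded_mfun_integrable; apply: bounded_mfunD (bounded_mfun_cst _).
under eq_integral do rewrite -[(2^-1 * _)%R]addr0.
rewrite fineD ?fin_numM// !fineM//=.
by field.
Qed.

End bounded_expectation.

(** * Self-similarity of the Cantor measure *)
Section cantor_transform.
Context {R : realType}.
Local Notation RR := (measurableTypeR R).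

Lemma binary_digitS n (x : R) : binary_digit n.+1 x = binary_digit n (2 * x).
Proof. by rewrite /binary_digit !mulrA -!exprSr. Qed.

Lemma binary_digitD1 n (x : R) : binary_digit n (x + 1) = binary_digit n x.
Proof.
have fl k : Num.floor (2 ^+ k * (x + 1)) = (Num.floor (2 ^+ k * x) + 2 ^+ k :> int).
  have e : (2 : R) ^+ k = (2 ^+ k : int)%:~R by rewrite rmorphXn.
  by rewrite mulrDr mulr1 [X in Num.floor (_ + X)]e floorDrz ?intr_int// intrKfloor.
rewrite /binary_digit !fl !intrD !rmorphXn/=.
by rewrite exprS; ring.
Qed.

Lemma cantor_map_unfold (x : R) :
  cantor_map x = 2 / 3 * binary_digit 0 x + 3^-1 * cantor_map (2 * x).
Proof.
rewrite /cantor_map; apply/cvg_lim => //.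
rewrite -(cvg_shiftn 1)/=.
rewrite (_ : (fun n => _) = (fun n => 2 / 3 * binary_digit 0 x +
   3^-1 * series (fun n => 2 * binary_digit n (2 * x) / 3 ^+ n.+1) n)); last first.
  apply/funext => n; rewrite /series/= addn1 big_nat_recl//= expr1.
  congr (_ + _); first by rewrite mulrAC.
  rewrite big_distrr/=; apply: eq_bigr => i _.
  by rewrite binary_digitS exprS invfM; ring.
apply: cvgD; first exact: cvg_cst.
apply: cvgM; first exact: cvg_cst.
exact: is_cvg_cantor_map.
Qed.

Lemma cantor_mapD1 (x : R) : cantor_map (x + 1) = cantor_map x.
Proof.
rewrite /cantor_map; congr (limn (series _)).
by apply/funext => n; rewrite binary_digitD1.
Qed.

Lemma cantor_map_ge0 (x : R) : 0 <= cantor_map x.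
Proof.
apply: limr_ge; first exact: is_cvg_cantor_map.
apply: nearW => n; rewrite /series/=; apply: sumr_ge0 => i _.
by rewrite divr_ge0// mulr_ge0// binary_digit_ge0.
Qed.

Lemma cantor_map_le1 (x : R) : cantor_map x <= 1.
Proof.
apply: limr_le; first exact: is_cvg_cantor_map.
apply: nearW => n; rewrite /series/=.
apply: (@le_trans _ _ (1 - (3 ^+ n)^-1)); last by rewrite gerBl invr_ge0 exprn_ge0.
elim: n => [|n IHn]; first by rewrite big_nil expr0 invr1 subrr.
rewrite big_nat_recr//=; have := binary_digit_le1 n x.
have p0 : 0 < (3 ^+ n.+1 : R)^-1 by rewrite invr_gt0 exprn_gt0.
move: IHn; rewrite (_ : (3 ^+ n : R)^-1 = 3 * (3 ^+ n.+1)^-1); last first.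
  by rewrite exprS invfM; field; rewrite expf_neq0.
set p := _^-1 in p0 *; set S := \sum_(_ <= _ < _) _.
nra.
Qed.

Lemma cantor_map_left_half (x : R) : 0 <= x < 1 ->
  cantor_map (2^-1 * x + 0) = 0 + 3^-1 * cantor_map x.
Proof.
move=> x01; rewrite cantor_map_unfold addr0 [2 * (_ * _)]mulrA divff// mul1r; congr (_ + _).
rewrite /binary_digit expr1 expr0 mul1r [2 * (_ * _)]mulrA divff// mul1r.
have -> : Num.floor x = 0 by apply/floor_def; rewrite add0r; lra.
have -> : Num.floor (2^-1 * x) = 0 by apply/floor_def; rewrite add0r; lra.
by rewrite mulr0 subr0 mulr0.
Qed.

Lemma cantor_map_right_half (x : R) : 0 <= x < 1 ->
  cantor_map (2^-1 * x + 2^-1) = 2 / 3 + 3^-1 * cantor_map x.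
Proof.
move=> x01; have e : 2 * (2^-1 * x + 2^-1) = x + 1 by field.
rewrite cantor_map_unfold e cantor_mapD1; congr (_ + _).
rewrite /binary_digit expr1 expr0 mul1r e.
have -> : Num.floor (x + 1) = 1 by apply/floor_def; rewrite intrD; lra.
have -> : Num.floor (2^-1 * x + 2^-1) = 0 by apply/floor_def; rewrite add0r; lra.
by rewrite mulr0 subr0 mulr1.
Qed.

(** The first binary digit is a fair coin, and the following ones have the same
law as all of them. *)
Lemma expect_cantor_selfsim (G : R -> R) : measurable_fun [set: RR] (G : RR -> R) ->
  (exists M, forall x, `|G x| <= M) ->
  expect (fun x => G (cantor_map x)) =
    2^-1 * expect (fun x => G (3^-1 * cantor_map x)) +
    2^-1 * expect (fun x => G (2 / 3 + 3^-1 * cantor_map x)).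
Proof.
move=> mG [M GM].
have mc : measurable_fun [set: RR] (@cantor_map R) := @measurable_cantor_map R.
have b0 : bounded_mfun (fun x => G (cantor_map x) : R).
  by split; [exact: measurableT_comp mG mc|exists M => x; exact: GM].
have b1 a b : bounded_mfun (fun x => G (a + b * cantor_map x) : R).
  split; last by exists M => x; exact: GM.
  apply: (measurableT_comp mG).
  by apply: measurable_funD => //; exact: measurable_funM.
have -> : (fun x : RR => G (3^-1 * cantor_map x)) = (fun x => G (0 + 3^-1 * cantor_map x)).
  by apply/funext => x; rewrite add0r.
rewrite expect_halves//; congr (_ * _ + _ * _); apply: eq_expect01 => //.
- exact: (bounded_mfun_comp_affine _ _ b0).
- by move=> x x01; congr G; exact: cantor_map_left_half.
- exact: (bounded_mfun_comp_affine _ _ b0).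
- by move=> x x01; congr G; exact: cantor_map_right_half.
Qed.

End cantor_transform.

(** * Complex numbers and complex expectations *)
Section cabs.
Context {R : realType}.
Implicit Types z w : R[i].

Lemma cabsE z : cabs z = Num.sqrt (complex.Re z ^+ 2 + complex.Im z ^+ 2).
Proof. by case: z. Qed.

Lemma normc_cabs z : `|z| = (cabs z)%:C%C.
Proof. by case: z. Qed.

Lemma cabs_ge0 z : 0 <= cabs z.
Proof. by rewrite cabsE sqrtr_ge0. Qed.

Lemma sqr_cabs z : cabs z ^+ 2 = complex.Re z ^+ 2 + complex.Im z ^+ 2.
Proof. by rewrite cabsE sqr_sqrtr// addr_ge0// sqr_ge0. Qed.

Lemma cabsM z w : cabs (z * w) = cabs z * cabs w.
Proof. exact: (Normc.normcM z w). Qed.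

Lemma cabsD z w : cabs (z + w) <= cabs z + cabs w.
Proof. by have := ler_normD z w; rewrite !normc_cabs -rmorphD/= lecR. Qed.

Lemma cabsN z : cabs (- z) = cabs z.
Proof. by rewrite !cabsE raddfN/= raddfN/= !sqrrN. Qed.

Lemma cabsB z w : cabs (z - w) <= cabs z + cabs w.
Proof. by rewrite -(cabsN w) cabsD. Qed.

Lemma cabs_distC z w : cabs (z - w) = cabs (w - z).
Proof. by rewrite -cabsN opprB. Qed.

Lemma cabs0 : cabs (0 : R[i]) = 0.
Proof. by rewrite cabsE/= expr0n/= addr0 sqrtr0. Qed.

Lemma cabs_real (r : R) : cabs (r%:C)%C = `|r|.
Proof. by rewrite cabsE/= expr0n/= addr0 sqrtr_sqr. Qed.

Lemma cabs1 : cabs (1 : R[i]) = 1.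
Proof. by rewrite (cabs_real 1) normr1. Qed.

Lemma cabsX z n : cabs (z ^+ n) = cabs z ^+ n.
Proof. by elim: n => [|n IHn]; rewrite ?expr0 ?cabs1// !exprS cabsM IHn. Qed.

Lemma cabs_sum (I : Type) (r : seq I) (P : pred I) (F : I -> R[i]) :
  cabs (\sum_(i <- r | P i) F i) <= \sum_(i <- r | P i) cabs (F i).
Proof.
elim/big_rec2 : _ => [|i x y _ xy]; first by rewrite cabs0.
by rewrite (le_trans (cabsD _ _))// lerD2l.
Qed.

Lemma normr_Re_cabs z : `|complex.Re z| <= cabs z.
Proof. by rewrite cabsE -sqrtr_sqr ler_wsqrtr// lerDl sqr_ge0. Qed.

Lemma normr_Im_cabs z : `|complex.Im z| <= cabs z.
Proof. by rewrite cabsE -sqrtr_sqr ler_wsqrtr// lerDr sqr_ge0. Qed.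

Lemma cabs_le_ReIm z : cabs z <= `|complex.Re z| + `|complex.Im z|.
Proof.
rewrite -[leRHS]ger0_norm ?addr_ge0// -sqrtr_sqr cabsE ler_wsqrtr// sqrrD.
rewrite !real_normK ?num_real//.
by rewrite [leRHS]addrAC lerDl mulrn_wge0// mulr_ge0.
Qed.

Lemma ReD z w : complex.Re (z + w) = complex.Re z + complex.Re w.
Proof. by case: z w => [a b] [c d]. Qed.
Lemma ImD z w : complex.Im (z + w) = complex.Im z + complex.Im w.
Proof. by case: z w => [a b] [c d]. Qed.
Lemma ReN z : complex.Re (- z) = - complex.Re z. Proof. by case: z. Qed.
Lemma ImN z : complex.Im (- z) = - complex.Im z. Proof. by case: z. Qed.
Lemma ReM z w : complex.Re (z * w) =
  complex.Re z * complex.Re w - complex.Im z * complex.Im w.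
Proof. by case: z w => [a b] [c d]. Qed.
Lemma ImM z w : complex.Im (z * w) =
  complex.Re z * complex.Im w + complex.Im z * complex.Re w.
Proof. by case: z w => [a b] [c d]. Qed.
Lemma complex_eqP z w :
  complex.Re z = complex.Re w -> complex.Im z = complex.Im w -> z = w.
Proof. by case: z w => [a b] [c d] /= -> ->. Qed.

Lemma Re_sum (I : Type) (r : seq I) (P : pred I) (F : I -> R[i]) :
  complex.Re (\sum_(i <- r | P i) F i) = \sum_(i <- r | P i) complex.Re (F i).
Proof. by elim/big_rec2 : _ => // i x y _ <-; rewrite ReD. Qed.
Lemma Im_sum (I : Type) (r : seq I) (P : pred I) (F : I -> R[i]) :
  complex.Im (\sum_(i <- r | P i) F i) = \sum_(i <- r | P i) complex.Im (F i).
Proof. by elim/big_rec2 : _ => // i x y _ <-; rewrite ImD. Qed.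

Definition cis (t : R) : R[i] := (cos t +i* sin t)%C.

Lemma cisD s t : cis (s + t) = cis s * cis t.
Proof. by apply: complex_eqP; rewrite ?ReM ?ImM /= ?cosD ?sinD//; ring. Qed.

Lemma cis0 : cis 0 = 1.
Proof. by rewrite /cis cos0 sin0. Qed.

Lemma cisMn t n : cis (n%:R * t) = cis t ^+ n.
Proof.
elim: n => [|n IHn]; first by rewrite mul0r cis0.
by rewrite exprS -IHn -cisD -natr1 mulrDl mul1r addrC.
Qed.

Lemma cabs_cis t : cabs (cis t) = 1.
Proof. by rewrite cabsE/= cos2Dsin2 sqrtr1. Qed.

Lemma cabs_cexp z : cabs (cexp z) = expR (complex.Re z).
Proof. by rewrite cabsM cabs_real cabs_cis mulr1 ger0_norm// expR_ge0. Qed.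

Lemma cexpD z w : cexp (z + w) = cexp z * cexp w.
Proof.
rewrite /cexp -!/(cis _) ReD ImD expRD cisD.
by rewrite rmorphM/= mulrACA.
Qed.

End cabs.

Section complex_expectation.
Context {R : realType}.
Local Notation RR := (measurableTypeR R).
Implicit Types f g : RR -> R[i].

Definition bounded_cmfun f := bounded_mfun (fun x => complex.Re (f x)) /\
  bounded_mfun (fun x => complex.Im (f x)).

Definition cexpect f : R[i] :=
  (expect (fun x => complex.Re (f x)) +i* expect (fun x => complex.Im (f x)))%C.

Lemma bounded_cmfunM f g : bounded_cmfun f -> bounded_cmfun g ->
  bounded_cmfun (fun x => f x * g x).
Proof.
move=> [rf jf] [rg jg]; split.
  under eq_fun do rewrite ReM; by apply: bounded_mfunB; apply: bounded_mfunM.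
under eq_fun do rewrite ImM; by apply: bounded_mfunD; apply: bounded_mfunM.
Qed.

Lemma bounded_cmfun1 : bounded_cmfun (fun=> 1).
Proof. by split => /=; exact: bounded_mfun_cst. Qed.

Lemma bounded_cmfunX f n : bounded_cmfun f -> bounded_cmfun (fun x => f x ^+ n).
Proof.
move=> bf; elim: n => [|n IHn]; first by under eq_fun do rewrite expr0; exact: bounded_cmfun1.
by under eq_fun do rewrite exprS; exact: bounded_cmfunM.
Qed.

Lemma cexpectB f g : bounded_cmfun f -> bounded_cmfun g ->
  cexpect (fun x => f x - g x) = cexpect f - cexpect g.
Proof.
move=> [rf jf] [rg jg]; apply: complex_eqP => /=.
  by under [X in expect X]eq_fun do rewrite ReD ReN; rewrite expectB.
by under [X in expect X]eq_fun do rewrite ImD ImN; rewrite expectB.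
Qed.

Lemma cabs_cexpect_le f M : bounded_cmfun f -> (forall x, cabs (f x) <= M) ->
  cabs (cexpect f) <= 2 * M.
Proof.
move=> [rf jf] fM; rewrite (le_trans (cabs_le_ReIm _))// mulr_natl mulr2n lerD//.
  by apply: normr_expect_le => // x; exact: le_trans (normr_Re_cabs _) (fM x).
by apply: normr_expect_le => // x; exact: le_trans (normr_Im_cabs _) (fM x).
Qed.

End complex_expectation.

Section cantor_coefficients.
Context {R : realType}.
Local Notation RR := (measurableTypeR R).

Definition cantor_angle : RR -> R := fun x => 1 / 2 + 3 / 2 * cantor_map x.

Lemma cantor_angle_itv x : 2^-1 <= cantor_angle x <= 2.
Proof.
by have := @cantor_map_ge0 R x; have := @cantor_map_le1 R x; rewrite /cantor_angle; lra.
Qed.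

Lemma measurable_cantor_angle : measurable_fun [set: RR] cantor_angle.
Proof.
apply: measurable_funD => //; apply: measurable_funM => //.
exact: (@measurable_cantor_map R).
Qed.

Lemma bounded_mfun_comp (G : R -> R) M (t : RR -> R) :
  measurable_fun [set: RR] (G : RR -> R) -> (forall x, `|G x| <= M) ->
  measurable_fun [set: RR] t -> bounded_mfun (fun x => G (t x)).
Proof.
move=> mG GM mt; split; last by exists M => x; exact: GM.
exact: (measurableT_comp mG mt).
Qed.

Lemma measurable_cosR : measurable_fun [set: RR] (cos : RR -> R).
Proof. exact: continuous_measurable_fun (@continuous_cos R). Qed.
Lemma measurable_sinR : measurable_fun [set: RR] (sin : RR -> R).
Proof. exact: continuous_measurable_fun (@continuous_sin R). Qed.

Lemma bounded_mfun_cos (t : RR -> R) : measurable_fun [set: RR] t ->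
  bounded_mfun (fun x => cos (t x)).
Proof. by apply: bounded_mfun_comp measurable_cosR (@cos_max R). Qed.
Lemma bounded_mfun_sin (t : RR -> R) : measurable_fun [set: RR] t ->
  bounded_mfun (fun x => sin (t x)).
Proof. by apply: bounded_mfun_comp measurable_sinR (@sin_max R). Qed.

Lemma bounded_cmfun_cis (t : RR -> R) : measurable_fun [set: RR] t ->
  bounded_cmfun (fun x => cis (t x)).
Proof. by move=> mt; split; [exact: bounded_mfun_cos|exact: bounded_mfun_sin]. Qed.

(** Pulling integrals back to the uniform variable makes every integrand bounded
on the whole line, as [cantor_angle] lies between 1/2 and 2 everywhere. *)
Lemma Rintegral_nu (G : R -> R) M :
  measurable_fun [set: RR] (G : RR -> R) -> (forall x, `|G x| <= M) ->
  \int[nu]_theta G theta = expect (fun x => G (cantor_angle x)).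
Proof.
move=> mG GM.
have mE : measurable_fun [set: RR] (EFin \o (G : RR -> R)).
  exact/measurable_EFinP.
have mr := @measurable_rescale R.
have iG : (uniform_prob (@ltr01 R)).-integrable [set: RR]
    (EFin \o (fun x => G (cantor_angle x))).
  by apply: bounded_mfun_integrable; apply: bounded_mfun_comp mG GM measurable_cantor_angle.
rewrite /expect /Rintegral /nu; congr fine.
have mE2 : measurable_fun [set: RR] ((EFin \o (G : RR -> R)) \o rescale).
  exact: measurableT_comp.
rewrite (@integral_distribution _ _ _ _ _ _ _ (EFin \o (G : RR -> R)))//.
  by rewrite (@integral_distribution _ _ _ _ _ _ _ ((EFin \o (G : RR -> R)) \o rescale)).
apply: measurable_bounded_integrable => //.
- by have /= -> := @probability_setT _ _ _ (@cantor_measure R); rewrite ltry.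
- exact: measurableT_comp mG mr.
- exists M; split; first exact: num_real.
  by move=> y My x _; exact: le_trans (GM _) (ltW My).
Qed.

(** For z = e^{i theta}, multiplying by (1 - z)^-1 inverts the difference operator
b(n) - b(n + 1) on the sequence z ^ n. *)
Definition twisted_coef k n : R[i] := cexpect (fun x =>
  cis (cantor_angle x) ^+ n * (1 - cis (cantor_angle x))^-1 ^+ k).

Lemma nu_hatE n : nu_hat n = twisted_coef 0 n.
Proof.
have mn : measurable_fun [set: RR] ((fun x => n%:R * x) : RR -> R) by exact: measurable_funM.
rewrite /nu_hat (@Rintegral_nu (fun x => cos (n%:R * x)) 1); last 2 first.
- exact: (measurableT_comp measurable_cosR mn).
- by move=> x; exact: cos_max.
rewrite (@Rintegral_nu (fun x => sin (n%:R * x)) 1); last 2 first.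
- exact: (measurableT_comp measurable_sinR mn).
- by move=> x; exact: sin_max.
rewrite /twisted_coef /cexpect; congr (_ +i* _)%C; congr expect; apply/funext => x;
  by rewrite expr0 mulr1 -cisMn.
Qed.

End cantor_coefficients.

(** * Twisted Fourier coefficients *)
Section twisted.
Context {R : realType}.
Local Notation RR := (measurableTypeR R).
Local Notation theta := (@cantor_angle R).

Lemma cos_cantor_angle x : cos (theta x) <= cos 2^-1.
Proof.
have := cantor_angle_itv x; have := @pi_ge2 R => pi2 /andP[t0 t2].
by rewrite leNgt ltr_cos ?in_itv/=; lra.
Qed.

Lemma cos_half_lt1 : cos (2^-1 : R) < 1.
Proof. by rewrite -[ltRHS]cos0 ltr_cos ?in_itv/=; have := @pi_ge2 R; lra. Qed.

Lemma sqr_cabs_1Bcis (t : R) : cabs (1 - cis t) ^+ 2 = 2 * (1 - cos t).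
Proof. by rewrite sqr_cabs /= sub0r sqrrN; have := cos2Dsin2 t; lra. Qed.

Lemma one_sub_cis_neq0 x : 1 - cis (theta x) != 0.
Proof.
apply/negP => /eqP e; have := sqr_cabs_1Bcis (theta x).
rewrite e cabs0 expr0n/=; have := cos_cantor_angle x; have := cos_half_lt1; lra.
Qed.

(** The logarithm makes the measurability of the inverse a composition of
measurable functions. *)
Lemma inv_1Bcis (t : R) : cos t < 1 ->
  (1 - cis t)^-1 = (2^-1 +i* (2^-1 * (sin t * expR (- ln (1 - cos t)))))%C.
Proof.
move=> ct; rewrite expRN lnK ?posrE ?subr_gt0//.
have c0 : 1 - cos t != 0 by rewrite subr_eq0 gt_eqF.
have nz : 1 - cis t != 0.
  apply/negP => /eqP e; have := sqr_cabs_1Bcis t.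
  by rewrite e cabs0 expr0n/= => /esym/eqP; rewrite mulf_eq0 (negbTE c0) orbF pnatr_eq0.
apply: (mulfI nz); rewrite mulfV//.
have cs : sin t ^+ 2 = (1 - cos t) * (1 + cos t).
  by have := cos2Dsin2 t; rewrite -subr_sqr expr1n; lra.
apply: complex_eqP; rewrite ?ReM ?ImM /= sub0r mulNr; last by field.
rewrite opprK.
have -> : sin t * (2^-1 * (sin t / (1 - cos t))) = 2^-1 * (sin t ^+ 2 / (1 - cos t)).
  by rewrite expr2; ring.
by rewrite cs; field.
Qed.

Lemma bounded_cmfun_theta : bounded_cmfun (fun x : RR => cis (theta x)).
Proof. by apply: (@bounded_cmfun_cis _ theta); exact: measurable_cantor_angle. Qed.

Lemma cabs_inv_1Bcis_le x : cabs (1 - cis (theta x))^-1 <= expR (- ln (1 - cos 2^-1)) + 1.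
Proof.
have c1 := cos_half_lt1; have cx := cos_cantor_angle x.
rewrite inv_1Bcis; last lra.
rewrite (le_trans (cabs_le_ReIm _))//= addrC lerD//; last by rewrite ger0_norm; lra.
rewrite !normrM [X in _ * (_ * X)]ger0_norm ?expR_ge0//.
rewrite ger0_norm ?invr_ge0//.
have : `|sin (theta x)| <= 1 := sin_max _.
have : expR (- ln (1 - cos (theta x))) <= expR (- ln (1 - cos 2^-1)).
  by rewrite ler_expR lerN2 ler_ln ?posrE; lra.
have := expR_ge0 (- ln (1 - cos (theta x))); have := normr_ge0 (sin (theta x)); nra.
Qed.

Lemma bounded_cmfun_inv_1Bcis : bounded_cmfun (fun x : RR => (1 - cis (theta x))^-1).
Proof.
have mt := @measurable_cantor_angle R.
have lt1 x : cos (theta x) < 1.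
  by apply: le_lt_trans (cos_cantor_angle x) cos_half_lt1.
split; split; try by exists (expR (- ln (1 - cos 2^-1)) + 1) => x;
    apply: le_trans (cabs_inv_1Bcis_le x); rewrite ?normr_Re_cabs ?normr_Im_cabs.
  rewrite [X in measurable_fun _ X](_ : _ = cst 2^-1); first exact: measurable_cst.
  by apply/funext => x; rewrite inv_1Bcis.
rewrite [X in measurable_fun _ X](_ : _ =
  (fun x => 2^-1 * (sin (theta x) * expR (- ln (1 - cos (theta x)))))); last first.
  by apply/funext => x; rewrite inv_1Bcis.
apply: measurable_funM => //; apply: measurable_funM.
  exact: (bounded_mfun_sin mt).1.
apply: (measurableT_comp (@measurable_expR R)).
apply: measurable_funN.
apply: (measurableT_comp (@measurable_ln R)).
by apply: measurable_funB => //; exact: (bounded_mfun_cos mt).1.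
Qed.

Lemma bounded_cmfun_twist k n : bounded_cmfun (fun x : RR =>
  cis (theta x) ^+ n * (1 - cis (theta x))^-1 ^+ k).
Proof.
apply: bounded_cmfunM; apply: bounded_cmfunX; first exact: bounded_cmfun_theta.
exact: bounded_cmfun_inv_1Bcis.
Qed.

Lemma twisted_coefB k n :
  twisted_coef k.+1 n - twisted_coef k.+1 n.+1 = twisted_coef k n :> R[i].
Proof.
rewrite /twisted_coef -cexpectB; try exact: bounded_cmfun_twist.
congr cexpect; apply/funext => x.
have := mulfV (one_sub_cis_neq0 x); rewrite !exprS.
set w := (1 - _)^-1; set z := cis _ => zw.
by transitivity (z ^+ n * w ^+ k * ((1 - z) * w)); [ring|rewrite zw mulr1].
Qed.

Lemma twisted_coef_bounded k :
  exists2 B : R, 0 <= B & forall n, cabs (twisted_coef k n : R[i]) <= B.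
Proof.
pose W : R := (expR (- ln (1 - cos 2^-1)) + 1).
exists (2 * W ^+ k).
  by rewrite mulr_ge0// exprn_ge0// addr_ge0// expR_ge0.
move=> n; apply: cabs_cexpect_le; first exact: bounded_cmfun_twist.
move=> x; rewrite cabsM !cabsX cabs_cis expr1n mul1r.
by rewrite lerXn2r ?nnegrE ?cabs_ge0 ?addr_ge0 ?expR_ge0// cabs_inv_1Bcis_le.
Qed.

End twisted.

Section cantor_product.
Context {R : realType}.
Local Notation RR := (measurableTypeR R).

(** The characteristic function of the unscaled Cantor measure. *)
Definition cantor_cf (u : R) : R[i] := cexpect (fun x : RR => cis (u * cantor_map x)).

Lemma measurable_scaled_cantor (a b : R) :
  measurable_fun [set: RR] ((fun x => a + b * cantor_map x) : RR -> R).
Proof.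
apply: measurable_funD => //; apply: measurable_funM => //.
exact: (@measurable_cantor_map R).
Qed.

Lemma cexpect_cis_shift (a b : R) :
  cexpect (fun x : RR => cis (a + b * cantor_map x)) = cis a * cantor_cf b.
Proof.
have m0 : measurable_fun [set: RR] ((fun x => b * cantor_map x) : RR -> R).
  by have := measurable_scaled_cantor 0 b; under eq_fun do rewrite add0r.
have bc := bounded_mfun_cos m0; have bs := bounded_mfun_sin m0.
apply: complex_eqP; rewrite ?ReM ?ImM /=.
  under [X in expect X]eq_fun do rewrite cosD.
  by rewrite expectB ?expectZ//; exact: bounded_mfunZ.
under [X in expect X]eq_fun do rewrite sinD.
rewrite expectD ?expectZ//; try exact: bounded_mfunZ.
by rewrite addrC.
Qed.

(** The two halves of the Cantor set are translates by 0 and 2/3 of its image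
under x |-> x / 3. *)
Lemma cantor_cf_selfsim u :
  cantor_cf u = (2^-1)%:C%C * (1 + cis (2 / 3 * u)) * cantor_cf (u / 3).
Proof.
have m (a b : R) : measurable_fun [set: RR] ((fun x => a + b * x) : RR -> R).
  by apply: measurable_funD => //; exact: measurable_funM.
have mu : measurable_fun [set: RR] ((fun x => u * x) : RR -> R).
  by exact: measurable_funM.
have e : cantor_cf u = (2^-1)%:C%C * cexpect (fun x : RR => cis (0 + u / 3 * cantor_map x)) +
    (2^-1)%:C%C * cexpect (fun x : RR => cis (2 / 3 * u + u / 3 * cantor_map x)).
  apply: complex_eqP; rewrite ?ReD ?ImD ?ReM ?ImM /= ?mul0r ?subr0 ?addr0.
    rewrite (@expect_cantor_selfsim R (fun y => cos (u * y))).
    - congr (_ * expect _ + _ * expect _); apply/funext => x; congr cos; first by ring.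
      by ring.
    - exact: measurableT_comp measurable_cosR mu.
    - by exists 1 => x; exact: cos_max.
  rewrite (@expect_cantor_selfsim R (fun y => sin (u * y))).
  - congr (_ * expect _ + _ * expect _); apply/funext => x; congr sin; first by ring.
    by ring.
  - exact: measurableT_comp measurable_sinR mu.
  - by exists 1 => x; exact: sin_max.
by rewrite e !cexpect_cis_shift cis0 -mulrDr -mulrDl mulrA.
Qed.

Lemma sqr_cabs_1Dcis (t : R) : cabs (1 + cis t) ^+ 2 = 2 * (1 + cos t).
Proof. by rewrite sqr_cabs /= add0r; have := cos2Dsin2 t; lra. Qed.

Lemma sqr_cabs_cantor_cf u : cabs (cantor_cf u) ^+ 2 =
  (1 + cos (2 / 3 * u)) / 2 * cabs (cantor_cf (u / 3)) ^+ 2.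
Proof.
rewrite [in LHS]cantor_cf_selfsim !cabsM !exprMn sqr_cabs_1Dcis cabs_real.
by rewrite real_normK ?num_real//; field.
Qed.

Lemma sqr_cabs_cantor_cf_le k u : cabs (cantor_cf u) ^+ 2 <=
  4 * \prod_(j < k) ((1 + cos (2 / 3 * u / 3 ^+ j)) / 2).
Proof.
elim: k u => [|k IHk] u.
  rewrite big_ord0 mulr1 (_ : 4 = (2 * 1) ^+ 2); last by rewrite mulr1 expr2; ring.
  rewrite lerXn2r ?nnegrE ?cabs_ge0 ?mulr_ge0//.
  apply: cabs_cexpect_le => [|x]; last by rewrite cabs_cis.
  apply: bounded_cmfun_cis.
  by have := measurable_scaled_cantor 0 u; under eq_fun do rewrite add0r.
rewrite sqr_cabs_cantor_cf big_ord_recl/= expr0 divr1 [leRHS]mulrCA.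
apply: ler_wpM2l; first by rewrite divr_ge0//; have := cos_geN1 (2 / 3 * u); lra.
have := IHk (u / 3); congr (_ <= _ * _).
apply: eq_bigr => j _; rewrite /bump/= add1n exprS; congr ((_ + cos _) / _).
by rewrite invfM; ring.
Qed.

Lemma sqr_cabs_nu_hat_le k n : cabs (nu_hat n : R[i]) ^+ 2 <=
  4 * \prod_(j < k) ((1 + cos (n%:R / 3 ^+ j : R)) / 2).
Proof.
have -> : nu_hat n = cis (n%:R / 2) * cantor_cf (3 / 2 * n%:R) :> R[i].
  rewrite -cexpect_cis_shift nu_hatE /twisted_coef; congr cexpect; apply/funext => x.
  rewrite expr0 mulr1 -cisMn; congr cis; rewrite /cantor_angle; ring.
rewrite cabsM cabs_cis mul1r (le_trans (sqr_cabs_cantor_cf_le k _))//.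
rewrite le_eqVlt; apply/orP; left; apply/eqP; congr (_ * _).
by apply: eq_bigr => j _; congr ((_ + cos _) / _); field; rewrite expf_neq0.
Qed.

End cantor_product.

(** * The mean square of the Fourier coefficients *)
Section reciprocal_sums.
Context {R : realType}.

Definition harmonic_sum (N : nat) : R := \sum_(1 <= i < N) i%:R^-1.

Lemma le_harmonic_sum M N : (M <= N)%N -> harmonic_sum M <= harmonic_sum N.
Proof.
move=> MN; rewrite /harmonic_sum; case: (leqP 1 M) => M1; last first.
  by rewrite big_geq ?(ltnW M1)// sumr_ge0.
by rewrite [leRHS](big_cat_nat M1 MN)/= lerDl sumr_ge0.
Qed.

(** As 0^-1 = 0, the diagonal term i = m can stay in the sum. *)
Lemma sum_inv_dist_le N m : (m < N)%N ->
  \sum_(0 <= i < N) `|m%:R - i%:R : R|^-1 <= 2 * harmonic_sum N.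
Proof.
move=> mN; rewrite (big_cat_nat (leq0n m) (ltnW mN))/= mulr_natl mulr2n lerD//.
  apply: le_trans (le_harmonic_sum mN).
  rewrite big_nat_rev/= add0n /harmonic_sum big_add1/= !big_nat.
  apply: ler_sum => i /= im; rewrite -natrB; last lia.
  by rewrite normr_nat (_ : (m - (m - i.+1) = i.+1)%N)//; lia.
rewrite big_ltn// subrr normr0 invr0 add0r.
apply: le_trans (le_harmonic_sum (leq_subr m N)).
rewrite -[X in \sum_(X <= _ < _) _]add1n -{1}[N](@subnK m)//; last exact: ltnW.
rewrite big_addn addnK /harmonic_sum !big_nat; apply: ler_sum => i /andP[i1 iN].
by rewrite distrC natrD addrK normr_nat.
Qed.

Lemma harmonic_sum_exp3 k : harmonic_sum (3 ^ k) <= 2 * k%:R.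
Proof.
elim: k => [|k IHk]; first by rewrite expn0 /harmonic_sum big_geq// mulr0.
have e1 : (1 <= 3 ^ k)%N by rewrite expn_gt0.
have e2 : (3 ^ k <= 3 ^ k.+1)%N by rewrite leq_exp2l.
rewrite /harmonic_sum (big_cat_nat e1 e2)/= -/(harmonic_sum _).
have -> : 2 * k.+1%:R = 2 * k%:R + 2 :> R by rewrite -[k.+1%:R]natr1 mulrDr mulr1.
rewrite lerD//.
apply: (@le_trans _ _ (\sum_(3 ^ k <= i < 3 ^ k.+1) (3 ^ k)%:R^-1)).
  rewrite !big_nat; apply: ler_sum => i /andP[ki _].
  by rewrite lef_pV2 ?posrE ?ltr0n ?ler_nat// (leq_trans e1).
rewrite sumr_const_nat -[_ *+ _]mulr_natr expnS (_ : (3 * 3 ^ k - 3 ^ k = 2 * 3 ^ k)%N); last lia.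
by rewrite natrM mulrCA mulVf ?mulr1// pnatr_eq0 -lt0n.
Qed.

End reciprocal_sums.

Section dirichlet_kernel.
Context {R : realType}.

(** By the mean value theorem sin x = x cos c with c between 0 and x, and cos
decreases between 0 and 1. *)
Lemma normr_sin_ge (x : R) : `|x| <= 1 -> cos 1 * `|x| <= `|sin x|.
Proof.
wlog x0 : x / 0 <= x => [hw|].
  case: (leP 0 x) => [|xlt0]; first exact: hw.
  by move=> xlt1; rewrite -normrN -[leRHS]normrN -sinN; apply: hw; rewrite ?normrN; lra.
rewrite ger0_norm// => x1.
have dsin y : y \in `]0, x[%R -> is_derive y 1 (@sin R) (cos y).
  by move=> ?; exact: is_derive_sin.
have csin : {within `[0, x], continuous (@sin R)}.
  by apply: continuous_subspaceT => y; exact: continuous_sin.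
have [c] := MVT_segment x0 dsin csin.
rewrite in_itv/= sin0 !subr0 => cx ->.
have pi2 := @pi_ge2 R.
have cc : cos 1 <= cos c by rewrite leNgt ltr_cos ?in_itv/=; lra.
have c0 : 0 < cos (1 : R) by exact: cos1_gt0.
have cc0 : 0 <= cos c by lra.
by rewrite ger0_norm ?mulr_ge0// ler_wpM2r.
Qed.

(** Multiplying by 2 sin (g / 2) makes the sum telescope. *)
Lemma dirichlet_kernelE N (g : R) : 2 * sin (g / 2) * \sum_(0 <= n < N) cos (n%:R * g) =
  sin (N%:R * g - g / 2) + sin (g / 2).
Proof.
elim: N => [|N IHN]; first by rewrite big_nil mulr0 mul0r sub0r sinN addNr.
rewrite big_nat_recr//= mulrDr IHN.
have -> : N.+1%:R * g - g / 2 = N%:R * g + g / 2 by rewrite -[N.+1%:R]natr1; field.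
by rewrite !sinD cosN sinN; ring.
Qed.

Lemma dirichlet_kernel_le N (g : R) : g != 0 -> `|g| <= 2 ->
  `|\sum_(0 <= n < N) cos (n%:R * g)| <= 2 / cos 1 * `|g|^-1.
Proof.
move=> g0 g2; have c0 : 0 < cos (1 : R) by exact: cos1_gt0.
have : cos 1 * `|g / 2| <= `|sin (g / 2)|.
  by apply: normr_sin_ge; rewrite normrM [X in _ * X]ger0_norm ?invr_ge0//; lra.
rewrite normrM [`|2^-1|]ger0_norm ?invr_ge0// => hs.
have gp : 0 < `|g| by rewrite normr_gt0.
have : `|2 * sin (g / 2) * \sum_(0 <= n < N) cos (n%:R * g)| <= 2.
  rewrite dirichlet_kernelE (le_trans (ler_normD _ _))//.
  have := sin_max (N%:R * g - g / 2); have := sin_max (g / 2); lra.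
rewrite !normrM [`|2|]ger0_norm//.
set S := `|\sum_(_ <= _ < _) _| => hS.
rewrite -mulrA -invfM ler_pdivlMr ?mulr_gt0//.
have S0 : 0 <= S by exact: normr_ge0.
by nra.
Qed.

End dirichlet_kernel.

Section cantor_mean_square.
Context {R : realType}.

(** The integers below 3 ^ k whose ternary digits are all 0 or 1: the frequencies of
the product of the 1 + z ^ (3 ^ j) for j < k. *)
Fixpoint ternary01 k : seq nat :=
  if k is k'.+1 then ternary01 k' ++ map (addn (3 ^ k')) (ternary01 k') else [:: 0%N].

Lemma size_ternary01 k : size (ternary01 k) = (2 ^ k)%N.
Proof. by elim: k => // k IHk; rewrite /= size_cat size_map IHk expnS; lia. Qed.

Lemma ternary01_lt k m : m \in ternary01 k -> (2 * m < 3 ^ k)%N.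
Proof.
elim: k m => [|k IHk] m /=; first by rewrite inE => /eqP ->.
rewrite mem_cat expnS => /orP[/IHk|/mapP[m' /IHk h ->]]; first lia.
by rewrite mulnDr; lia.
Qed.

Lemma uniq_ternary01 k : uniq (ternary01 k).
Proof.
elim: k => // k IHk /=; rewrite cat_uniq IHk map_inj_uniq ?IHk; last exact: addnI.
rewrite andbT/=; apply/hasPn => x /mapP[m' _ ->].
by apply/negP => /ternary01_lt; lia.
Qed.

Lemma prod_1DX3 (z : R[i]) k :
  \prod_(j < k) (1 + z ^+ (3 ^ j)) = \sum_(m <- ternary01 k) z ^+ m.
Proof.
elim: k => [|k IHk]; first by rewrite big_ord0 big_seq1 expr0.
rewrite big_ord_recr/= IHk big_cat/= big_map mulrDr mulr1; congr (_ + _).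
by rewrite big_distrl/=; apply: eq_bigr => i _; rewrite exprD mulrC.
Qed.

Lemma sqr_cabs_sum_cis (s : seq nat) (b : R) :
  cabs (\sum_(m <- s) cis b ^+ m) ^+ 2 =
  \sum_(m <- s) \sum_(m' <- s) cos ((m%:R - m'%:R) * b).
Proof.
rewrite sqr_cabs Re_sum Im_sum !expr2 !big_distrl/= -big_split/=.
apply: eq_bigr => m _; rewrite !big_distrr/= -big_split/=; apply: eq_bigr => m' _.
by rewrite -!cisMn/= mulrBl cosB.
Qed.

(** In the variable b = n / 3 ^ (k-1), the j-th factor from the end has argument
3 ^ j * b, so the product is 4 ^ (- k) times the squared modulus of the exponential
sum with frequencies [ternary01 k]. *)
Lemma cantor_prodE k n : (0 < k)%N -> \prod_(j < k) ((1 + cos (n%:R / 3 ^+ j : R)) / 2) =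
  (4 ^+ k)^-1 * \sum_(m <- ternary01 k) \sum_(m' <- ternary01 k)
     cos (n%:R * ((m%:R - m'%:R) / 3 ^+ k.-1)).
Proof.
move=> k0; pose b : R := n%:R / 3 ^+ k.-1.
transitivity ((4 ^+ k)^-1 * cabs (\sum_(m <- ternary01 k) cis b ^+ m) ^+ 2); last first.
  rewrite sqr_cabs_sum_cis; congr (_ * _).
  apply: eq_bigr => m _; apply: eq_bigr => m' _; congr cos; rewrite /b; ring.
have cprod (F : 'I_k -> R[i]) : cabs (\prod_(j < k) F j) = \prod_(j < k) cabs (F j).
  by elim/big_rec2 : _ => [|i x y _ xy]; [exact: cabs1|rewrite cabsM -xy].
rewrite -prod_1DX3 cprod -prodrXl (reindex_inj rev_ord_inj)/=.
rewrite -exprVn -[in X in X * _](card_ord k) -prodr_const -big_split/=.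
apply: eq_bigr => j _.
rewrite -cisMn sqr_cabs_1Dcis.
have -> : n%:R / 3 ^+ (k - j.+1) = (3 ^ j)%:R * b.
  have jk := ltn_ord j.
  rewrite /b (_ : k.-1 = (k - j.+1 + j)%N); last lia.
  rewrite exprD natrX; field.
  by rewrite !expf_neq0.
by field.
Qed.

(** Expand the square and sum over n first.  The diagonal gives 2 ^ k * 3 ^ k.  Off
the diagonal the frequencies differ by less than 2 in absolute value, so the
Dirichlet kernel is O(3 ^ k / |m - m'|); since the elements of [ternary01 k] are
distinct integers, these terms add up to a harmonic sum, hence the factor
1 + k. *)
Lemma nu_hat_mean_square_log : exists2 C : R, 0 < C &
  forall k, \sum_(0 <= n < 3 ^ k) cabs (nu_hat n : R[i]) ^+ 2 <=
     C * (1 + k%:R) * (3 / 2) ^+ k.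
Proof.
have c0 : 0 < cos (1 : R) by exact: cos1_gt0.
pose c : R := 2 / cos 1.
have cp : 0 < c by rewrite divr_gt0.
exists (4 * (1 + 4 * c)); first by nra.
move=> k; have [->|k0] := posnP k.
  rewrite expn0 big_nat1 addr0 mulr1 expr0 mulr1.
  have := @sqr_cabs_nu_hat_le R 0 0; rewrite big_ord0; nra.
apply: (@le_trans _ _ (\sum_(0 <= n < 3 ^ k) 4 * \prod_(j < k) ((1 + cos (n%:R / 3 ^+ j : R)) / 2))).
  by apply: ler_sum => n _; exact: sqr_cabs_nu_hat_le.
under eq_bigr do rewrite cantor_prodE//.
rewrite -!big_distrr/= exchange_big/=.
under eq_bigr do rewrite exchange_big/=.
rewrite -!mulrA ler_pM2l// ler_pdivrMl ?exprn_gt0//.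
have inner m : m \in ternary01 k ->
    \sum_(m' <- ternary01 k) \sum_(0 <= n < 3 ^ k)
      cos (n%:R * ((m%:R - m'%:R) / 3 ^+ k.-1) : R) <=
    3 ^+ k + c * 3 ^+ k * (4 * k%:R).
  move=> mk.
  have hm := ternary01_lt mk.
  have term m' : m' \in ternary01 k -> \sum_(0 <= n < 3 ^ k)
      cos (n%:R * ((m%:R - m'%:R) / 3 ^+ k.-1) : R) <=
      (if m' == m then 3 ^+ k else 0) + c * 3 ^+ k * `|m%:R - m'%:R|^-1.
    move=> mk'; have hm' := ternary01_lt mk'.
    have [->|mm'] := eqVneq m' m.
      rewrite subrr normr0 invr0 mulr0 addr0 mul0r.
      under eq_bigr do rewrite mulr0 cos0.
      by rewrite sumr_const_nat subn0 -[_ *+ _]mulr_natr mul1r natrX.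
    rewrite add0r (le_trans (ler_norm _))//.
    have p0 : 0 < (3 ^+ k.-1 : R) by rewrite exprn_gt0.
    have mmR : `|m%:R - m'%:R : R| <= 2 * 3 ^+ k.-1.
      have hk : (3 ^ k = 3 * 3 ^ k.-1)%N by rewrite -expnS prednK.
      have h1 : (m%:R : R) <= 2 * 3 ^+ k.-1 by rewrite -natrX -natrM ler_nat; lia.
      have h2 : (m'%:R : R) <= 2 * 3 ^+ k.-1 by rewrite -natrX -natrM ler_nat; lia.
      have h3 : 0 <= (m%:R : R) by []; have h4 : 0 <= (m'%:R : R) by [].
      by rewrite ler_norml; lra.
    rewrite (le_trans (dirichlet_kernel_le _ _ _))//.
    - apply: mulf_neq0; last by rewrite invr_eq0 gt_eqF.
      by rewrite subr_eq0 eqr_nat eq_sym.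
    - by rewrite normrM normfV (ger0_norm (ltW p0)) ler_pdivrMr.
    - rewrite normrM normfV (ger0_norm (ltW p0)) invfM invrK -/c.
      have d0 : 0 <= `|m%:R - m'%:R : R|^-1 by rewrite invr_ge0.
      have e3 : 3 ^+ k = 3 * 3 ^+ k.-1 :> R by rewrite -exprS prednK.
      rewrite e3; have := mulr_ge0 (ltW cp) (mulr_ge0 (ltW p0) d0).
      by nra.
  rewrite big_seq; apply: le_trans; first by apply: ler_sum => m' hm'; exact: term.
  rewrite -big_seq big_split/= lerD//.
    rewrite (bigD1_seq m mk (uniq_ternary01 k)) eqxx big1 => [|i im]; first by rewrite [leLHS]addr0.
    by rewrite (negbTE im).
  rewrite -big_distrr; apply: ler_wpM2l.
    by apply: mulr_ge0; [exact: ltW|rewrite exprn_ge0].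
  apply: (@le_trans _ _ (2 * harmonic_sum (3 ^ k))); last first.
    rewrite (_ : 4 * k%:R = 2 * (2 * k%:R) :> R); last by ring.
    by rewrite ler_pM2l//; exact: harmonic_sum_exp3.
  apply: le_trans (@sum_inv_dist_le R (3 ^ k) m _); last by lia.
  rewrite /index_iota subn0 [leRHS](bigID (mem (ternary01 k)))/= -[leLHS]addr0 lerD//; last first.
    by apply: sumr_ge0 => i _; rewrite invr_ge0.
  rewrite -[leRHS]big_filter le_eqVlt; apply/orP; left; apply/eqP.
  apply: perm_big; apply: uniq_perm; rewrite ?uniq_ternary01 ?filter_uniq ?iota_uniq//.
  move=> x; rewrite mem_filter mem_iota /= add0n.
  case: (boolP (x \in ternary01 k)) => // /ternary01_lt h; rewrite andTb; apply/esym; lia.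
rewrite big_seq; apply: le_trans; first by apply: ler_sum => m hm; exact: inner.
rewrite -big_seq big_const_seq count_predT size_ternary01 iter_addr_0 -[_ *+ _]mulr_natr natrX.
have -> : 4 ^+ k * ((1 + 4 * c) * ((1 + k%:R) * (3 / 2) ^+ k)) =
   (1 + 4 * c) * (1 + k%:R) * (3 ^+ k * 2 ^+ k).
  rewrite (_ : 4 = 2 * 2 :> R); last by ring.
  by rewrite !exprMn exprVn; field; rewrite expf_neq0.
rewrite [leLHS](_ : _ = (1 + 4 * c * k%:R) * (3 ^+ k * 2 ^+ k)); last by ring.
apply: ler_wpM2r; first by rewrite mulr_ge0 ?exprn_ge0.
by have : 0 <= (k%:R : R) by []; nra.
Qed.

(** The ratio 169/100 lies strictly between 3/2 and the square root of 3; the first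
inequality absorbs the factor 1 + k. *)
Lemma nu_hat_mean_square : exists2 C : R, 0 < C &
  forall k, \sum_(0 <= n < 3 ^ k) cabs (nu_hat n : R[i]) ^+ 2 <=
     C * ((13 / 10) ^+ 2) ^+ k.
Proof.
have [C C0 hC] := nu_hat_mean_square_log.
have bern k : 1 + k%:R <= 10 * (169 / 150 : R) ^+ k.
  elim: k => [|k IHk]; first by rewrite expr0; lra.
  have : 1 <= (169 / 150 : R) ^+ k by rewrite exprn_ege1//; lra.
  by rewrite exprS -[k.+1%:R]natr1; lra.
exists (10 * C) => [|k]; first lra.
apply: (le_trans (hC k)).
rewrite (_ : (13 / 10) ^+ 2 = 169 / 150 * (3 / 2) :> R); last by rewrite expr2; field.
rewrite [(169 / 150 * _) ^+ k]exprMn [leRHS]mulrA; apply: ler_wpM2r; first by rewrite exprn_ge0//; lra.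
by have := bern k; nra.
Qed.

End cantor_mean_square.

(** * Differences of complex powers *)
Section complex_derivative.
Context {R : realType}.
Implicit Types (f g : R -> R[i]) (x : R).

(** Componentwise, so that the real mean value theorem applies. *)
Definition cderiv f x (d : R[i]) :=
  is_derive x 1 (fun y => complex.Re (f y) : R) (complex.Re d) /\
  is_derive x 1 (fun y => complex.Im (f y) : R) (complex.Im d).

Lemma is_derive_val (u : R -> R) x d d' :
  is_derive x 1 u d -> d = d' -> is_derive x 1 u d'.
Proof. by move=> h <-. Qed.

Lemma is_derive_mulR (u v : R -> R) x du dv : is_derive x 1 u du ->
  is_derive x 1 v dv -> is_derive x 1 (fun y => u y * v y) (du * v x + u x * dv).
Proof.
move=> hu hv; refine (is_derive_val (is_deriveM hu hv) _).
by rewrite /GRing.scale/= addrC [v x * _]mulrC.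
Qed.

Lemma is_derive_compR (u v : R -> R) x du dv : is_derive (v x) 1 u du ->
  is_derive x 1 v dv -> is_derive x 1 (fun y => u (v y)) (dv * du).
Proof. by move=> hu hv; refine (is_derive_val (is_derive1_comp hu hv) _); rewrite mulrC. Qed.

Lemma is_derive_addR (u v : R -> R) x du dv : is_derive x 1 u du ->
  is_derive x 1 v dv -> is_derive x 1 (fun y => u y + v y) (du + dv).
Proof. by move=> hu hv; exact: (is_deriveD hu hv). Qed.

Lemma is_derive_subR (u v : R -> R) x du dv : is_derive x 1 u du ->
  is_derive x 1 v dv -> is_derive x 1 (fun y => u y - v y) (du - dv).
Proof. by move=> hu hv; exact: (is_deriveB hu hv). Qed.

Lemma cderiv_val f x d d' : cderiv f x d -> d = d' -> cderiv f x d'.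
Proof. by move=> h <-. Qed.

Lemma cderiv_cst c x : cderiv (fun=> c) x 0.
Proof. by split; exact: is_derive_cst. Qed.

Lemma cderivD f g x a b : cderiv f x a -> cderiv g x b ->
  cderiv (fun y => f y + g y) x (a + b).
Proof.
move=> [rf jf] [rg jg]; split; rewrite ?ReD ?ImD.
  have -> : (fun y => complex.Re (f y + g y)) =
      (fun y => complex.Re (f y) + complex.Re (g y)) by apply/funext => y; rewrite ReD.
  exact: is_derive_addR.
have -> : (fun y => complex.Im (f y + g y)) =
    (fun y => complex.Im (f y) + complex.Im (g y)) by apply/funext => y; rewrite ImD.
exact: is_derive_addR.
Qed.

Lemma cderivM f g x a b : cderiv f x a -> cderiv g x b ->
  cderiv (fun y => f y * g y) x (a * g x + f x * b).
Proof.
move=> [rf jf] [rg jg]; split.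
  have -> : (fun y => complex.Re (f y * g y)) = (fun y => complex.Re (f y) * complex.Re (g y) -
      complex.Im (f y) * complex.Im (g y)) by apply/funext => y; rewrite ReM.
  refine (is_derive_val (is_derive_subR (is_derive_mulR rf rg) (is_derive_mulR jf jg)) _).
  by rewrite ReD !ReM; ring.
have -> : (fun y => complex.Im (f y * g y)) = (fun y => complex.Re (f y) * complex.Im (g y) +
    complex.Im (f y) * complex.Re (g y)) by apply/funext => y; rewrite ImM.
refine (is_derive_val (is_derive_addR (is_derive_mulR rf jg) (is_derive_mulR jf rg)) _).
by rewrite ImD !ImM; ring.
Qed.

Lemma cderivZ c f x a : cderiv f x a -> cderiv (fun y => c * f y) x (c * a).
Proof.
move=> hf; apply: cderiv_val; first exact: cderivM (cderiv_cst c x) hf.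
by rewrite mul0r add0r.
Qed.

Lemma cderivN f x a : cderiv f x a -> cderiv (fun y => - f y) x (- a).
Proof.
move=> hf; rewrite -mulN1r.
have -> : (fun y => - f y) = (fun y => -1 * f y) by apply/funext => y; rewrite mulN1r.
exact: cderivZ.
Qed.

Lemma cderivB f g x a b : cderiv f x a -> cderiv g x b ->
  cderiv (fun y => f y - g y) x (a - b).
Proof. by move=> hf hg; apply: cderivD => //; exact: cderivN. Qed.

Lemma cderiv_real (u : R -> R) x du : is_derive x 1 u du ->
  cderiv (fun y => (u y)%:C%C) x (du%:C)%C.
Proof. by move=> hu; split => //=; exact: is_derive_cst. Qed.

Lemma cderiv_id x : cderiv (fun y => y%:C%C) x 1.
Proof. by apply: (@cderiv_real id); exact: is_derive_id. Qed.

Lemma cderiv_cexp f x a : cderiv f x a -> cderiv (fun y => cexp (f y)) x (a * cexp (f x)).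
Proof.
move=> [rf jf].
have he : cderiv (fun y => (expR (complex.Re (f y)))%:C%C) x
    ((complex.Re a * expR (complex.Re (f x)))%:C)%C.
  by apply: cderiv_real; exact: is_derive_compR (is_derive_expR _) rf.
have hc : cderiv (fun y => cis (complex.Im (f y))) x
    ((complex.Im a * - sin (complex.Im (f x))) +i* (complex.Im a * cos (complex.Im (f x))))%C.
  split => /=; first exact: is_derive_compR (is_derive_cos _) jf.
  exact: is_derive_compR (is_derive_sin _) jf.
apply: cderiv_val; first exact: cderivM he hc.
by apply: complex_eqP; rewrite ?ReD ?ImD ?ReM ?ImM /= ?ReM ?ImM/=; ring.
Qed.

Lemma cderiv_shift f c x d : cderiv f (x + c) d -> cderiv (fun y => f (y + c)) x d.
Proof.
have hx : is_derive x 1 (fun y : R => y + c) 1.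
  have hid : is_derive x 1 (fun y : R => y) 1 by exact: is_derive_id.
  have hcst : is_derive x 1 (fun=> c) 0 by exact: is_derive_cst.
  by refine (is_derive_val (is_derive_addR hid hcst) _); rewrite addr0.
move=> [rf jf]; split.
  by refine (is_derive_val (@is_derive_compR _ (fun y => y + c) x _ _ rf hx) _); rewrite mul1r.
by refine (is_derive_val (@is_derive_compR _ (fun y => y + c) x _ _ jf hx) _); rewrite mul1r.
Qed.

Lemma is_derive_compare_le (u du w dw : R -> R) (a b : R) : a <= b ->
  (forall y, a <= y <= b -> is_derive y 1 u (du y)) ->
  (forall y, a <= y <= b -> is_derive y 1 w (dw y)) ->
  (forall y, a <= y <= b -> `|du y| <= dw y) -> `|u b - u a| <= w b - w a.
Proof.
move=> ab hu hw hM.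
have incr (v dv : R -> R) : (forall y, a <= y <= b -> is_derive y 1 v (dv y)) ->
    (forall y, a <= y <= b -> 0 <= dv y) -> 0 <= v b - v a.
  move=> hv v0; have hv' y : y \in `]a, b[%R -> is_derive y 1 v (dv y).
    by rewrite in_itv/= => yab; apply: hv; lra.
  have cv : {within `[a, b], continuous v}.
    apply: derivable_within_continuous => y; rewrite in_itv/= => yab.
    by have [] := hv _ yab.
  have [c] := MVT_segment ab hv' cv.
  by rewrite in_itv/= => cab ->; rewrite mulr_ge0 ?subr_ge0// v0.
have hD := incr (fun y => w y + u y) (fun y => dw y + du y)
  (fun y yab => is_derive_addR (hw y yab) (hu y yab)).
have hB := incr (fun y => w y - u y) (fun y => dw y - du y)
  (fun y yab => is_derive_subR (hw y yab) (hu y yab)).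
have {}hD : 0 <= (w b + u b) - (w a + u a).
  by apply: hD => y /hM; rewrite ler_norml; lra.
have {}hB : 0 <= (w b - u b) - (w a - u a).
  by apply: hB => y /hM; rewrite ler_norml; lra.
by rewrite ler_norml; lra.
Qed.

Lemma is_derive_mean_le (u du : R -> R) (a b M : R) : a <= b ->
  (forall y, a <= y <= b -> is_derive y 1 u (du y)) ->
  (forall y, a <= y <= b -> `|du y| <= M) -> `|u b - u a| <= M * (b - a).
Proof.
move=> ab hu hM.
have hw (y : R) : is_derive y 1 (fun z : R => M * z) M.
  have hid : is_derive y 1 (fun z : R => z) 1 by exact: is_derive_id.
  have hcst : is_derive y 1 (fun=> M) 0 by exact: is_derive_cst.
  by refine (is_derive_val (is_derive_mulR hcst hid) _); rewrite mul0r add0r mulr1.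
by rewrite mulrBr; apply: (@is_derive_compare_le u du (fun z => M * z) (fun=> M)).
Qed.

Lemma cderiv_mean_le f (f' : R -> R[i]) (a b M : R) : a <= b ->
  (forall y, a <= y <= b -> cderiv f y (f' y)) ->
  (forall y, a <= y <= b -> cabs (f' y) <= M) -> cabs (f b - f a) <= 2 * M * (b - a).
Proof.
move=> ab hf hM; rewrite (le_trans (cabs_le_ReIm _))//.
rewrite -mulrA mulr_natl mulr2n lerD//.
  rewrite ReD ReN; apply: (@is_derive_mean_le (fun y => complex.Re (f y)) (fun y => complex.Re (f' y)) a b M ab).
    by move=> y /hf[].
  by move=> y /hM; apply: le_trans; exact: normr_Re_cabs.
rewrite ImD ImN; apply: (@is_derive_mean_le (fun y => complex.Im (f y)) (fun y => complex.Im (f' y)) a b M ab).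
  by move=> y /hf[].
by move=> y /hM; apply: le_trans; exact: normr_Im_cabs.
Qed.

(** Apply the mean value inequality twice, first to f' and then to
y |-> f y - y f' 0; each use costs a factor 2, one for each component. *)
Lemma cderiv_taylor2_le f (f' f'' : R -> R[i]) (M : R) :
  (forall y, 0 <= y <= 1 -> cderiv f y (f' y)) ->
  (forall y, 0 <= y <= 1 -> cderiv f' y (f'' y)) ->
  (forall y, 0 <= y <= 1 -> cabs (f'' y) <= M) -> cabs (f 1 - f 0 - f' 0) <= 4 * M.
Proof.
move=> hf hf' hM; pose g y := f y - f' 0 * y%:C%C.
have -> : f 1 - f 0 - f' 0 = g 1 - g 0 by rewrite /g; ring.
have M0 : 0 <= M by apply: le_trans (hM 0 _); rewrite ?cabs_ge0//; lra.
rewrite (_ : 4 * M = 2 * (2 * M) * (1 - 0)); last by ring.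
apply: (@cderiv_mean_le g (fun y => f' y - f' 0)) => // [y yI|y /andP[y0 y1]].
  apply: cderiv_val; first exact: cderivB (hf _ yI) (cderivZ _ (cderiv_id _)).
  by rewrite mulr1.
apply: (@le_trans _ _ (2 * M * (y - 0))); last by rewrite subr0 ler_piMr// mulr_ge0.
apply: (@cderiv_mean_le _ f'') => // z zI; first by apply: hf'; lra.
by apply: hM; lra.
Qed.

End complex_derivative.

Section finite_differences.
Context {R : realType}.
Implicit Types (f g : R -> R[i]) (s h : R[i]) (x : R).

Fixpoint fdiff k f x : R[i] :=
  if k is k'.+1 then fdiff k' f (x + 1) - fdiff k' f x else f x.

Lemma fdiffD k f g x : fdiff k (fun y => f y + g y) x = fdiff k f x + fdiff k g x.
Proof. by elim: k x => //= k IHk x; rewrite !IHk; ring. Qed.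

Lemma fdiffZ k c f x : fdiff k (fun y => c * f y) x = c * fdiff k f x.
Proof. by elim: k x => //= k IHk x; rewrite !IHk; ring. Qed.

Lemma cderiv_fdiff k f f' x : 0 < x -> (forall y, 0 < y -> cderiv f y (f' y)) ->
  cderiv (fdiff k f) x (fdiff k f' x).
Proof.
move=> x0 hf; elim: k x x0 => [|k IHk] x x0; first exact: hf.
by apply: cderivB; [apply: cderiv_shift; apply: IHk; lra|exact: IHk].
Qed.

Lemma cderiv_fdiff_param k (F F' : R -> R -> R[i]) x t :
  0 < x -> (forall y, 0 < y -> cderiv (F^~ y) t (F' t y)) ->
  cderiv (fun u => fdiff k (F u) x) t (fdiff k (F' t) x).
Proof.
move=> x0 hF; elim: k x x0 => [|k IHk] x x0; first exact: hF.
by apply: cderivB; apply: IHk; lra.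
Qed.

(** The functions x ^ (- s) (ln x) ^ m form the smallest family containing the
x ^ (- s) and stable, up to linear combinations, under derivation in x and in
s. *)
Definition lpow m s x : R[i] := ((ln x) ^+ m)%:C%C * cexp (- s * (ln x)%:C%C).

Lemma lpow0_natpow s n : lpow 0 s n%:R = natpow n (- s).
Proof. by rewrite /lpow expr0 mul1r. Qed.

Lemma lpowS m s x : lpow m.+1 s x = (ln x)%:C%C * lpow m s x.
Proof. by rewrite /lpow exprS rmorphM/= mulrA. Qed.

Lemma lpowD1 m s x : 0 < x -> lpow m (s + 1) x = (x^-1)%:C%C * lpow m s x.
Proof.
move=> x0; rewrite /lpow opprD mulrDl cexpD mulN1r.
have -> : cexp (- (ln x)%:C%C) = (x^-1)%:C%C :> R[i].
  rewrite /cexp /= oppr0 cos0 sin0 expRN lnK ?posrE//.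
  by rewrite -/(1%:C%C) mulr1.
by ring.
Qed.

Lemma cabs_lpow m s x : cabs (lpow m s x) = `|ln x| ^+ m * expR (- complex.Re s * ln x).
Proof.
rewrite cabsM cabs_real normrX cabs_cexp; congr (_ * expR _).
by rewrite ReM/= mulr0 subr0 ReN.
Qed.

Lemma cderiv_lpow m s x : 0 < x ->
  cderiv (lpow m s) x (m%:R * lpow m.-1 (s + 1) x + - s * lpow m (s + 1) x).
Proof.
move=> x0; have hl := is_derive1_ln x0.
have hp : cderiv (fun y => cexp (- s * (ln y)%:C%C)) x
    (- s * (x^-1)%:C%C * cexp (- s * (ln x)%:C%C)).
  by apply: cderiv_cexp; apply: cderivZ; exact: cderiv_real.
elim: m => [|m IHm].
  have -> : lpow 0 s = fun y => cexp (- s * (ln y)%:C%C).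
    by apply/funext => y; rewrite /lpow expr0 mul1r.
  apply: cderiv_val; first exact: hp.
  rewrite mul0r add0r lpowD1// /lpow expr0 mul1r; ring.
have -> : lpow m.+1 s = fun y => (ln y)%:C%C * lpow m s y.
  by apply/funext => y; rewrite lpowS.
apply: cderiv_val; first exact: cderivM (cderiv_real hl) IHm.
rewrite [m.+1.-1]/= lpowS !lpowD1// -[m.+1%:R]natr1.
case: m {IHm} => [|m]; first by rewrite /=; ring.
by rewrite [m.+1.-1]/= lpowS; ring.
Qed.

Lemma cderiv_lpow_param m s h x t :
  cderiv (fun u => lpow m (s + u%:C%C * h) x) t (- h * lpow m.+1 (s + t%:C%C * h) x).
Proof.
have hc : cderiv (fun u => - (s + u%:C%C * h) * (ln x)%:C%C) t (- h * (ln x)%:C%C).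
  have -> : (fun u => - (s + u%:C%C * h) * (ln x)%:C%C) =
      (fun u => - s * (ln x)%:C%C + - h * (ln x)%:C%C * u%:C%C) by apply/funext => u; ring.
  apply: cderiv_val; first exact: cderivD (cderiv_cst _ _) (cderivZ _ (cderiv_id _)).
  by rewrite add0r mulr1.
apply: cderiv_val; first exact: cderivZ (cderiv_cexp hc).
by rewrite lpowS /lpow; ring.
Qed.

(** Each difference gains a factor 1 / x: by the mean value inequality it is bounded
by the derivative, which lies in the same family at s + 1.  The logarithms are
bounded by powers of x. *)
Lemma fdiff_lpow_le k m (r : R) : 0 <= r -> exists2 C, 0 <= C &
  forall s, cabs s <= r -> forall x, 1 <= x ->
    cabs (fdiff k (lpow m s) x) <= C * expR ((m%:R - complex.Re s - k%:R) * ln x).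
Proof.
elim: k m r => [|k IHk] m r r0.
  exists 1 => // s _ x x1; rewrite /= cabs_lpow subr0 mul1r mulrBl expRD mulNr.
  have x0 : 0 < x by lra.
  apply: ler_wpM2r; first exact: expR_ge0.
  rewrite expRM_natl; apply: lerXn2r; rewrite ?nnegrE ?expR_ge0//.
  rewrite ger0_norm ?ln_ge0// lnK ?posrE//.
  exact: ltW (ln_sublinear x0).
have r1 : 0 <= r + 1 by lra.
have [C1 C10 h1] := IHk m.-1 (r + 1) r1.
have [C2 C20 h2] := IHk m (r + 1) r1.
exists (2 * ((m%:R * C1 + r * C2) * expR (m%:R + r + k%:R + 1))).
  by rewrite mulr_ge0// mulr_ge0 ?expR_ge0// addr_ge0// mulr_ge0.
move=> s sr x x1; have x0 : 0 < x by lra.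
have sr1 : cabs (s + 1) <= r + 1 by rewrite (le_trans (cabsD _ _))// cabs1 lerD2r.
set p := m%:R - complex.Re s - k.+1%:R.
rewrite /= [leRHS](_ : _ = 2 * ((m%:R * C1 + r * C2) *
   (expR (m%:R + r + k%:R + 1) * expR (p * ln x))) * (x + 1 - x)); last by ring.
apply: (@cderiv_mean_le _ _ (fdiff k (fun y => m%:R * lpow m.-1 (s + 1) y + - s * lpow m (s + 1) y))).
- lra.
- move=> y yx; apply: cderiv_fdiff; first lra.
  by move=> z z0; exact: cderiv_lpow.
move=> y yx; have y1 : 1 <= y by lra.
rewrite fdiffD !fdiffZ.
have lny : 0 <= ln y by exact: ln_ge0.
have lnyx : ln x <= ln y <= ln x + 1.
  apply/andP; split; first by rewrite ler_ln ?posrE; lra.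
  rewrite -lerBlDl -ln_div ?posrE; [|lra|lra].
  have -> : y / x = 1 + (y / x - 1) by ring.
  apply: (le_trans (le_ln1Dx _)).
    by rewrite ltrBrDl subrr divr_gt0; lra.
  by rewrite lerBlDl ler_pdivrMr//; lra.
have step (C q : R) : 0 <= C -> q <= p -> C * expR (q * ln y) <=
    C * (expR (m%:R + r + k%:R + 1) * expR (p * ln x)).
  move=> C0 qp; apply: ler_wpM2l => //; rewrite -expRD ler_expR.
  apply: (@le_trans _ _ (p * ln y)); first by rewrite ler_wpM2r.
  have : `|p| <= m%:R + r + k%:R + 1.
    rewrite /p -[k.+1%:R]natr1 ler_norml.
    have := normr_Re_cabs s; rewrite ler_norml.
    have : 0 <= (m%:R : R) by []; have : 0 <= (k%:R : R) by []; lra.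
  have := ler_norm p; have := ler_norm (- p); rewrite normrN; nra.
have res : complex.Re (s + 1) = complex.Re s + 1 by rewrite ReD.
rewrite (le_trans (cabsD _ _))// mulrDl lerD//.
  rewrite cabsM -(rmorph_nat (real_complex R)) cabs_real normr_nat -!mulrA.
  apply: ler_wpM2l => //; apply: le_trans (h1 _ sr1 _ y1) (step _ _ C10 _).
  rewrite /p res -[k.+1%:R]natr1.
  have : m.-1%:R <= (m%:R : R) by rewrite ler_nat leq_pred.
  lra.
rewrite cabsM cabsN -!mulrA; apply: ler_pM => //; rewrite ?cabs_ge0//.
apply: le_trans (h2 _ sr1 _ y1) (step _ _ C20 _).
rewrite /p res -[k.+1%:R]natr1; lra.
Qed.

(** Taylor's formula along the segment from s to s + h; derivation in s commutes with
differences in x and multiplies by - ln x. *)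
Lemma fdiff_lpow_taylor k s h x (M : R) : 0 < x ->
  (forall t, 0 <= t <= 1 -> cabs (fdiff k (lpow 2 (s + t%:C%C * h)) x) <= M) ->
  cabs (fdiff k (lpow 0 (s + h)) x - fdiff k (lpow 0 s) x
        + h * fdiff k (lpow 1 s) x) <= 4 * (cabs h ^+ 2 * M).
Proof.
move=> x0 hM.
have := @cderiv_taylor2_le R (fun t => fdiff k (lpow 0 (s + t%:C%C * h)) x)
  (fun t => - h * fdiff k (lpow 1 (s + t%:C%C * h)) x)
  (fun t => - h * (- h * fdiff k (lpow 2 (s + t%:C%C * h)) x)) (cabs h ^+ 2 * M).
rewrite mul1r mul0r addr0 mulNr opprK; apply.
- move=> y _; rewrite -fdiffZ.
  by apply: (@cderiv_fdiff_param k (fun u => lpow 0 (s + u%:C%C * h))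
      (fun u z => - h * lpow 1 (s + u%:C%C * h) z)) => // z z0;
    exact: cderiv_lpow_param.
- move=> y _; apply: cderivZ; rewrite -fdiffZ.
  by apply: (@cderiv_fdiff_param k (fun u => lpow 1 (s + u%:C%C * h))
      (fun u z => - h * lpow 2 (s + u%:C%C * h) z)) => // z z0;
    exact: cderiv_lpow_param.
move=> y yI; rewrite !cabsM cabsN mulrA -expr2 ler_wpM2l ?sqr_ge0// ?exprn_ge0 ?cabs_ge0//.
exact: hM.
Qed.

End finite_differences.

(** * Convergence and differentiability of complex functions *)
Section complex_convergence.
Context {R : realType}.
Implicit Types (u v : nat -> R[i]) (l : R[i]).

(** The distance is a real sequence, which gives access to the order lemmas on real
limits. *)
Definition cconv u l := (fun n => cabs (u n - l)) @ \oo --> (0 : R).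

Lemma cconvP u l (e : nat -> R) : (forall n, cabs (u n - l) <= e n) ->
  e @ \oo --> (0 : R) -> cconv u l.
Proof.
move=> ue e0; apply: (squeeze_cvgr _ (cvg_cst 0) e0).
by apply: nearW => n; rewrite cabs_ge0 ue.
Qed.

Lemma cconvD u v l l' : cconv u l -> cconv v l' -> cconv (fun n => u n + v n) (l + l').
Proof.
move=> ul vl; apply: (cconvP (e := fun n => cabs (u n - l) + cabs (v n - l'))).
  by move=> n; rewrite opprD addrACA cabsD.
by rewrite -[X in _ --> X]addr0; exact: cvgD.
Qed.

Lemma cconvZ c u l : cconv u l -> cconv (fun n => c * u n) (c * l).
Proof.
move=> ul; apply: (cconvP (e := fun n => cabs c * cabs (u n - l))).
  by move=> n; rewrite -mulrBr cabsM.
by rewrite -[X in _ --> X](mulr0 (cabs c)); apply: cvgMr.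
Qed.

Lemma cconvN u l : cconv u l -> cconv (fun n => - u n) (- l).
Proof.
by move=> /(cconvZ (-1)); rewrite mulN1r; under eq_fun do rewrite mulN1r.
Qed.

Lemma cconvB u v l l' : cconv u l -> cconv v l' -> cconv (fun n => u n - v n) (l - l').
Proof. by move=> ul vl; apply: cconvD => //; exact: cconvN. Qed.

Lemma cconv_cst l : cconv (fun=> l) l.
Proof. by rewrite /cconv; under eq_fun do rewrite subrr cabs0; exact: cvg_cst. Qed.

Lemma cconv_le u l M : cconv u l -> (\forall n \near \oo, cabs (u n) <= M) -> cabs l <= M.
Proof.
move=> ul uM; have h : (fun n => M + cabs (u n - l)) @ \oo --> (M : R).
  by rewrite -[X in _ --> X]addr0; apply: cvgD ul; exact: cvg_cst.
have <- := cvg_lim (@Rhausdorff R) h.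
apply: limr_ge; first by apply/cvg_ex; exists M.
near=> n; have un : cabs (u n) <= M by near: n.
rewrite [leLHS](_ : _ = cabs (u n - (u n - l))); last by congr cabs; ring.
by rewrite (le_trans (cabsB _ _))// lerD.
Unshelve. all: by end_near. Qed.

Lemma cconv_unique u l l' : cconv u l -> cconv u l' -> l = l'.
Proof.
move=> ul ul'; apply/eqP; rewrite -subr_eq0; apply/eqP.
have h0 : cabs (l - l') <= 0.
  by apply: (cconv_le (cconvB ul ul')); apply: nearW => n; rewrite subrr cabs0.
have e : cabs (l - l') = 0 by apply/eqP; rewrite eq_le h0 cabs_ge0.
have := sqr_cabs (l - l'); rewrite e expr0n/= => /esym/eqP.
rewrite paddr_eq0 ?sqr_ge0// !sqrf_eq0 => /andP[/eqP hr /eqP hi].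
exact: complex_eqP.
Qed.

Lemma cconv_ReIm u : cvgn (fun n => complex.Re (u n)) -> cvgn (fun n => complex.Im (u n)) ->
  exists l, cconv u l.
Proof.
move=> cr ci.
exists ((limn (fun n => complex.Re (u n))) +i* (limn (fun n => complex.Im (u n))))%C.
apply: (cconvP (e := fun n => `|complex.Re (u n) - limn (fun n => complex.Re (u n))|
   + `|complex.Im (u n) - limn (fun n => complex.Im (u n))|)).
  by move=> n; rewrite (le_trans (cabs_le_ReIm _))// ReD ImD ReN ImN.
rewrite -[X in _ --> X]addr0; apply: cvgD.
  by apply/norm_cvg0P; apply/subr_cvg0.
by apply/norm_cvg0P; apply/subr_cvg0.
Qed.

Lemma sum_inv_sqr_le N : \sum_(0 <= n < N) (n.+1%:R ^+ 2 : R)^-1 <= 2.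
Proof.
case: N => [|N]; first by rewrite big_nil.
suff : \sum_(0 <= n < N.+1) (n.+1%:R ^+ 2 : R)^-1 <= 2 - N.+1%:R^-1.
  by move=> h; apply: le_trans h _; rewrite gerBl invr_ge0.
elim: N => [|N IHN]; first by rewrite big_nat1 expr1n invr1; lra.
rewrite big_nat_recr//=; apply: le_trans (lerD IHN (lexx _)) _.
have n0 : 0 < (N.+1%:R : R) by rewrite ltr0n.
have -> : N.+2%:R = N.+1%:R + 1 :> R by rewrite -natr1.
set x : R := N.+1%:R in n0 *.
have h : (x + 1)^-1 + ((x + 1) ^+ 2)^-1 <= x^-1.
  rewrite -subr_ge0 (_ : _ - _ = (x * (x + 1) ^+ 2)^-1); last by field; lra.
  by rewrite invr_ge0 mulr_ge0 ?sqr_ge0 ?ltW.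
by move: ((x + 1) ^- 2) (x + 1)^-1 x^-1 h => a b c; lra.
Qed.

Lemma cconv_series_inv_sqr u K : 0 <= K ->
  (forall n, cabs (u n) <= K * (n.+1%:R ^+ 2)^-1) ->
  exists l, cconv (fun N => \sum_(0 <= n < N) u n) l.
Proof.
move=> K0 uK.
have aux (w : nat -> R) : (forall n, `|w n| <= cabs (u n)) -> cvgn (series w).
  move=> wu; apply: normed_cvg; apply: nondecreasing_is_cvgn.
    by apply: nondecreasing_series => n _; rewrite normr_ge0.
  exists (K * 2) => _ [n _ <-]; rewrite /series/=.
  apply: (@le_trans _ _ (\sum_(0 <= i < n) K * (i.+1%:R ^+ 2)^-1)).
    by apply: ler_sum => i _; exact: le_trans (wu i) (uK i).
  by rewrite -big_distrr/= ler_wpM2l// sum_inv_sqr_le.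
apply: cconv_ReIm.
  under eq_fun do rewrite Re_sum; apply: (aux (fun n => complex.Re (u n))) => n.
  exact: normr_Re_cabs.
under eq_fun do rewrite Im_sum; apply: (aux (fun n => complex.Im (u n))) => n.
exact: normr_Im_cabs.
Qed.

Lemma cconv_series_le u l K : 0 <= K ->
  (forall n, cabs (u n) <= K * (n.+1%:R ^+ 2)^-1) ->
  cconv (fun N => \sum_(0 <= n < N) u n) l -> cabs l <= 2 * K.
Proof.
move=> K0 uK hl; apply: (cconv_le hl); apply: nearW => N.
rewrite (le_trans (cabs_sum _ _ _))//.
apply: (@le_trans _ _ (\sum_(0 <= i < N) K * (i.+1%:R ^+ 2)^-1)); first exact: ler_sum.
by rewrite -big_distrr/= mulrC ler_wpM2r// sum_inv_sqr_le.
Qed.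

Definition cseries u : R[i] :=
  xget 0 [set l | cconv (fun N => \sum_(0 <= n < N) u n) l].

Lemma cconv_cseries u : (exists l, cconv (fun N => \sum_(0 <= n < N) u n) l) ->
  cconv (fun N => \sum_(0 <= n < N) u n) (cseries u).
Proof. by move=> hl; exact: (@xgetPex _ 0 [set l | cconv (fun N => \sum_(0 <= n < N) u n) l] hl). Qed.

Lemma cvg_expR_ln0 (a : R) : 0 < a ->
  (fun n : nat => expR (- a * ln n.+1%:R)) @ \oo --> (0 : R).
Proof.
move=> a0; apply/cvgrPdist_le => e e0.
near=> n.
rewrite sub0r normrN ger0_norm ?expR_ge0//.
rewrite -[leRHS]lnK ?posrE// ler_expR mulNr lerNl.
rewrite mulrC -ler_pdivrMr//.
rewrite -[leLHS](expRK) ler_ln ?posrE ?expR_gt0//.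
have : expR (- ln e / a) <= n%:R by near: n; exact: nbhs_infty_ger.
by move=> h; rewrite -natr1 (le_trans h)// lerDl.
Unshelve. all: by end_near. Qed.

End complex_convergence.

Section quadratic_differentiability.
Context {R : realType}.
Implicit Types (F G : R[i] -> R[i]) (z h d : R[i]).

(** Differentiability with a quadratic remainder: unlike differentiability, it passes
to infinite sums with summable remainders. *)
Definition cdiff F z d := exists2 K : R, 0 <= K &
  forall h, cabs h <= 1 -> cabs (F (z + h) - F z - h * d) <= K * cabs h ^+ 2.

Lemma cdiffD F G z d d' : cdiff F z d -> cdiff G z d' ->
  cdiff (fun s => F s + G s) z (d + d').
Proof.
move=> [K K0 hF] [K' K'0 hG]; exists (K + K') => [|h h1]; first exact: addr_ge0.
rewrite (_ : _ - _ = (F (z + h) - F z - h * d) + (G (z + h) - G z - h * d')); last by ring.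
by rewrite (le_trans (cabsD _ _))// mulrDl lerD// ?hF ?hG.
Qed.

Lemma cdiffZ c F z d : cdiff F z d -> cdiff (fun s => c * F s) z (c * d).
Proof.
move=> [K K0 hF]; exists (cabs c * K) => [|h h1]; first by rewrite mulr_ge0 ?cabs_ge0.
rewrite (_ : _ - _ = c * (F (z + h) - F z - h * d)); last by ring.
by rewrite cabsM -mulrA ler_wpM2l ?cabs_ge0// hF.
Qed.

Lemma cdiff_sum n (F : nat -> R[i] -> R[i]) z (d : nat -> R[i]) :
  (forall j, cdiff (F j) z (d j)) ->
  cdiff (fun s => \sum_(j < n) F j s) z (\sum_(j < n) d j).
Proof.
move=> hF; elim: n => [|n IHn].
  exists 0 => // h _; rewrite !big_ord0 subrr mulr0 subrr cabs0 mul0r//.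
rewrite big_ord_recr/=.
have -> : (fun s => \sum_(j < n.+1) F j s) = (fun s => \sum_(j < n) F j s + F n s).
  by apply/funext => s; rewrite big_ord_recr.
exact: cdiffD.
Qed.

Lemma cdiff_eq F G z d : (forall h, cabs h <= 1 -> F (z + h) = G (z + h)) ->
  cdiff F z d -> cdiff G z d.
Proof.
move=> FG [K K0 hF]; exists K => // h h1.
have := FG 0; rewrite cabs0 addr0 => <-//.
by rewrite -FG// hF.
Qed.

Lemma cdiff_derivable F z d : cdiff F z d -> derivable (F : R[i]^o -> R[i]^o) z 1.
Proof.
move=> [K K0 hF]; apply/cvg_ex; exists (d : R[i]^o).
apply/cvgrPdist_le => e e0.
have [er er0 eE] : exists2 er : R, 0 < er & e = (er%:C)%C.
  exists (complex.Re e); first by move: e0; rewrite ltcE /= => /andP[].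
  by move: e0; rewrite ltcE /= => /andP[/eqP i0 _]; apply: complex_eqP.
have K1 : 0 < K + 1 by lra.
near=> h.
have h0 : h != 0 by near: h; exact: nbhs_dnbhs_neq.
have hsmall : `|h| < ((Num.min 1 (er / (K + 1)))%:C)%C.
  near: h; apply: dnbhs0_lt.
  by rewrite ltcR lt_min ltr01 divr_gt0.
move: hsmall; rewrite normc_cabs ltcR lt_min => /andP[h1 he].
have hp : 0 < cabs h.
  by rewrite -ltcR -normc_cabs normr_gt0.
rewrite normc_cabs eE lecR.
rewrite -[_ *: _]/(h^-1 * (F (h * 1 + z) - F z)) mulr1 [h + z]addrC.
rewrite (_ : d - _ = - (h^-1 * (F (z + h) - F z - h * d))); last first.
  have hd : h^-1 * (h * d) = d by rewrite mulrA mulVf// mul1r.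
  by rewrite [h^-1 * (_ - h * d)]mulrBr hd opprB.
rewrite cabsN cabsM.
have hi : cabs h^-1 = (cabs h)^-1 by exact: (Normc.normcV h).
rewrite hi ler_pdivrMl//.
rewrite (le_trans (hF _ (ltW h1)))//.
move: he; rewrite ltr_pdivlMr// => he.
by nra.
Unshelve. all: by end_near. Qed.

Lemma cdiff_lipschitz F z d : cdiff F z d -> exists2 K : R, 0 <= K &
  forall h, cabs h <= 1 -> cabs (F (z + h) - F z) <= K * cabs h.
Proof.
move=> [K K0 hF]; exists (K + cabs d) => [|h h1]; first by rewrite addr_ge0 ?cabs_ge0.
rewrite (_ : _ - _ = (F (z + h) - F z - h * d) + h * d); last by ring.
rewrite (le_trans (cabsD _ _))// mulrDl cabsM [cabs d * _]mulrC lerD2r.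
apply: le_trans (hF _ h1) _; apply: ler_wpM2l => //.
by rewrite expr2 ler_piMr// cabs_ge0.
Qed.

End quadratic_differentiability.

(** * Continuation by repeated summation by parts *)
Section continuation.
Context {R : realType} (b : nat -> nat -> R[i]).
Context (b_bounded : forall k, exists2 B : R, 0 <= B & forall n, cabs (b k n) <= B).
Context (b_antidiff : forall k n, b k.+1 n - b k.+1 n.+1 = b k n).
Implicit Types (s h z : R[i]).

Definition zdiff k s (x : R) : R[i] := fdiff k (lpow 0 s) x.
Definition head_sum k s : R[i] := \sum_(j < k) b j.+1 j.+1 * zdiff j s 1.
Definition tail_term k s n : R[i] := b k (n.+1 + k) * zdiff k s n.+1%:R.
(** What k summations by parts turn the Dirichlet series into. *)
Definition abel_cont k s : R[i] := head_sum k s + cseries (tail_term k s).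

Lemma zdiffS k s n :
  zdiff k.+1 s n.+1%:R = zdiff k s n.+2%:R - zdiff k s n.+1%:R.
Proof. by rewrite /zdiff /= -[n.+2%:R]natr1. Qed.

Lemma abel_step k s N : \sum_(0 <= n < N) tail_term k s n =
  b k.+1 k.+1 * zdiff k s 1 - b k.+1 (N.+1 + k) * zdiff k s N.+1%:R
  + \sum_(0 <= n < N) tail_term k.+1 s n.
Proof.
elim: N => [|N IHN]; first by rewrite !big_nil add1n subrr addr0.
rewrite !big_nat_recr//= IHN /tail_term -(b_antidiff k (N.+1 + k)).
have -> : (N.+1 + k.+1 = (N.+1 + k).+1)%N by rewrite addnS.
have -> : (N.+2 + k = (N.+1 + k).+1)%N by rewrite addSn.
rewrite zdiffS; ring.
Qed.

Lemma expR_ln_inv_sqr n (p : R) : p <= -2 ->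
  expR (p * ln n.+1%:R) <= (n.+1%:R ^+ 2)^-1.
Proof.
move=> p2; have n0 : 0 < (n.+1%:R : R) by rewrite ltr0n.
rewrite -{2}[n.+1%:R]lnK ?posrE// -expRM_natl -expRN ler_expR -mulNr.
by rewrite ler_wpM2r// ln_ge0// ler1n.
Qed.

Lemma zdiff_summable k m (r : R) : 0 <= r -> exists2 C : R, 0 <= C &
  forall s, cabs s <= r -> m%:R + 2 <= complex.Re s + k%:R ->
  forall n, cabs (fdiff k (lpow m s) n.+1%:R) <= C * (n.+1%:R ^+ 2)^-1.
Proof.
move=> r0; have [C C0 hC] := fdiff_lpow_le k m r0.
exists C => // s sr ks n; have n1 : 1 <= (n.+1%:R : R) by rewrite ler1n.
apply: le_trans (hC _ sr _ n1) _; rewrite ler_wpM2l// expR_ln_inv_sqr//; lra.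
Qed.

Lemma tail_term_summable k (r : R) : 0 <= r -> exists2 C : R, 0 <= C &
  forall s, cabs s <= r -> 2 <= complex.Re s + k%:R ->
  forall n, cabs (tail_term k s n) <= C * (n.+1%:R ^+ 2)^-1.
Proof.
move=> r0; have [C C0 hC] := @zdiff_summable k 0 r r0.
have [B B0 hB] := b_bounded k.
exists (B * C) => [|s sr ks n]; first exact: mulr_ge0.
rewrite cabsM -mulrA ler_pM ?cabs_ge0//; apply: hC => //.
by rewrite add0r.
Qed.

Lemma cconv_tail k s : 2 <= complex.Re s + k%:R ->
  cconv (fun N => \sum_(0 <= n < N) tail_term k s n) (cseries (tail_term k s)).
Proof.
move=> ks; apply: cconv_cseries.
have [C C0 hC] := @tail_term_summable k (cabs s) (cabs_ge0 _).
exact: cconv_series_inv_sqr C0 (hC s (lexx _) ks).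
Qed.

Lemma cconv_boundary k s : 0 < complex.Re s + k%:R ->
  cconv (fun N => b k.+1 (N.+1 + k) * zdiff k s N.+1%:R) 0.
Proof.
move=> ks; have [B B0 hB] := b_bounded k.+1.
have [C C0 hC] := @fdiff_lpow_le R k 0 (cabs s) (cabs_ge0 _).
apply: (cconvP (e := fun N => B * C * expR (- (complex.Re s + k%:R) * ln N.+1%:R))).
  move=> N; rewrite subr0 cabsM -mulrA ler_pM ?cabs_ge0//.
  have -> : - (complex.Re s + k%:R) = 0%:R - complex.Re s - k%:R by ring.
  by apply: hC; rewrite ?ler1n.
rewrite -[X in _ --> X](mulr0 (B * C)); apply: cvgMr.
exact: cvg_expR_ln0.
Qed.

Lemma abel_cont_step k s : 2 <= complex.Re s + k%:R ->
  abel_cont k s = abel_cont k.+1 s.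
Proof.
move=> ks; have ks1 : 2 <= complex.Re s + k.+1%:R by rewrite -[k.+1%:R]natr1; lra.
have h := cconvD (cconvB (cconv_cst (b k.+1 k.+1 * zdiff k s 1))
   (@cconv_boundary k s ltac:(lra))) (cconv_tail ks1).
rewrite subr0 in h.
have e : cseries (tail_term k s) = b k.+1 k.+1 * zdiff k s 1 + cseries (tail_term k.+1 s).
  apply: cconv_unique (cconv_tail ks) _.
  by under eq_fun do rewrite abel_step.
by rewrite /abel_cont e /head_sum big_ord_recr/= addrA.
Qed.

Lemma abel_cont_indep k k' s : 2 <= complex.Re s + k%:R ->
  2 <= complex.Re s + k'%:R -> abel_cont k s = abel_cont k' s.
Proof.
wlog kk' : k k' / (k <= k')%N => [hw ks ks'|ks _].
  by case: (leqP k k') => [|/ltnW] /hw; [exact|move=> <-].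
elim: k' kk' => [|k' IHk']; first by rewrite leqn0 => /eqP ->.
rewrite leq_eqVlt => /predU1P[->//|]; rewrite ltnS => kk'.
rewrite IHk'// abel_cont_step//.
by apply: le_trans ks _; rewrite lerD2l ler_nat.
Qed.

(** Large enough to work on the unit disc around s, with room for the two factors
ln n of the second derivative. *)
Definition abel_order s : nat := (Num.truncn (cabs s)).+1 + 5.

Lemma abel_orderP s : cabs s + 5 <= (abel_order s)%:R.
Proof.
rewrite natrD lerD2r; apply: ltW; exact: truncnS_gt.
Qed.

Definition abel_entire s : R[i] := abel_cont (abel_order s) s.

Lemma Re_geN s : - cabs s <= complex.Re s.
Proof. by have := normr_Re_cabs s; rewrite ler_norml => /andP[]. Qed.

Lemma abel_entireE k s : 2 <= complex.Re s + k%:R -> abel_entire s = abel_cont k s.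
Proof.
move=> ks; apply: abel_cont_indep => //.
have := abel_orderP s; have := Re_geN s; lra.
Qed.

Lemma cdiff_zdiff k z : cdiff (fun s => zdiff k s 1) z (- fdiff k (lpow 1 z) 1).
Proof.
have r0 : 0 <= cabs z + 1 by rewrite addr_ge0 ?cabs_ge0.
have [C C0 hC] := @fdiff_lpow_le R k 2 (cabs z + 1) r0.
exists (4 * C) => [|h h1]; first by rewrite mulr_ge0.
rewrite mulrN opprK (_ : 4 * C * _ = 4 * (cabs h ^+ 2 * C)); last by ring.
apply: fdiff_lpow_taylor => // t t01.
have ht : cabs (z + t%:C%C * h) <= cabs z + 1.
  rewrite (le_trans (cabsD _ _))// lerD2l cabsM cabs_real ger0_norm; last lra.
  by have := cabs_ge0 h; nra.
have := hC _ ht 1 (lexx _); by rewrite ln1 mulr0 expR0 mulr1.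
Qed.

(** The Taylor remainders of the terms are O(|h| ^ 2 / n ^ 2) uniformly for |h| <= 1,
so the quadratic remainder survives the summation. *)
Lemma cdiff_tail k z : cabs z + 5 <= k%:R ->
  exists d, cdiff (fun s => cseries (tail_term k s)) z d.
Proof.
move=> kz.
have r0 : 0 <= cabs z + 1 by rewrite addr_ge0 ?cabs_ge0.
have [B B0 hB] := b_bounded k.
have [C1 C10 hC1] := @zdiff_summable k 1 (cabs z + 1) r0.
have [C2 C20 hC2] := @zdiff_summable k 2 (cabs z + 1) r0.
have near_re h : cabs h <= 1 -> cabs (z + h) <= cabs z + 1 /\ 4 <= complex.Re (z + h) + k%:R.
  move=> h1; have zh : cabs (z + h) <= cabs z + 1.
    by rewrite (le_trans (cabsD _ _))// lerD2l.
  by split=> //; have := Re_geN (z + h); lra.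
have [zr zk] : cabs z <= cabs z + 1 /\ 4 <= complex.Re z + k%:R.
  by have := near_re 0; rewrite addr0 cabs0; apply.
pose u n := b k (n.+1 + k) * fdiff k (lpow 1 z) n.+1%:R.
have [d0 hd0] : exists l, cconv (fun N => \sum_(0 <= n < N) u n) l.
  apply: (@cconv_series_inv_sqr _ u (B * C1)); first exact: mulr_ge0.
  move=> n; rewrite cabsM -mulrA ler_pM ?cabs_ge0//; apply: hC1 => //; lra.
exists (- d0), (2 * (4 * (B * C2))) => [|h h1]; first by rewrite !mulr_ge0.
have [zhr zhk] := near_re h h1.
pose v n := tail_term k (z + h) n - tail_term k z n + h * u n.
have hv : cconv (fun N => \sum_(0 <= n < N) v n)
    (cseries (tail_term k (z + h)) - cseries (tail_term k z) - h * - d0).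
  have -> : (fun N => \sum_(0 <= n < N) v n) = (fun N =>
      (\sum_(0 <= n < N) tail_term k (z + h) n - \sum_(0 <= n < N) tail_term k z n)
      - (- h) * \sum_(0 <= n < N) u n).
    apply/funext => N; rewrite /v big_split/= sumrB -big_distrr/=.
    by rewrite mulNr opprK.
  rewrite mulrN -mulNr.
  apply: cconvB; last exact: cconvZ.
  by apply: cconvB; apply: cconv_tail; lra.
rewrite (_ : _ * _ ^+ 2 = 2 * (4 * (cabs h ^+ 2 * (B * C2)))); last by ring.
apply: cconv_series_le hv; first by rewrite !mulr_ge0 ?exprn_ge0 ?cabs_ge0.
move=> n.
have -> : v n = b k (n.+1 + k) * (zdiff k (z + h) n.+1%:R - zdiff k z n.+1%:R
    + h * fdiff k (lpow 1 z) n.+1%:R) by rewrite /v /u /tail_term; ring.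
rewrite cabsM (_ : _ * _^-1 = B * (4 * (cabs h ^+ 2 * (C2 * (n.+1%:R ^+ 2)^-1)))); last by ring.
rewrite ler_pM ?cabs_ge0//; apply: fdiff_lpow_taylor => // t t01.
have th : cabs (t%:C%C * h) <= 1.
  by rewrite cabsM cabs_real ger0_norm; have := cabs_ge0 h; nra.
have [? ?] := near_re _ th.
apply: hC2 => //; lra.
Qed.

Lemma abel_entire_cdiff z : exists d, cdiff abel_entire z d.
Proof.
pose k := abel_order z.
have kz : cabs z + 5 <= k%:R := abel_orderP z.
have [d hd] := cdiff_tail kz.
exists (\sum_(j < k) b j.+1 j.+1 * (- fdiff j (lpow 1 z) 1) + d).
apply: (@cdiff_eq _ (abel_cont k)); last first.
  apply: cdiffD hd.
  apply: (@cdiff_sum _ k (fun j s => b j.+1 j.+1 * zdiff j s 1)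
     z (fun j => b j.+1 j.+1 * (- fdiff j (lpow 1 z) 1))) => j.
  exact/cdiffZ/cdiff_zdiff.
move=> h h1; rewrite -abel_entireE//.
have := Re_geN (z + h); have := cabsD z h; lra.
Qed.

Lemma abel_entire_entire : entire abel_entire.
Proof. by move=> z; have [d hd] := abel_entire_cdiff z; exact: cdiff_derivable hd. Qed.

Lemma tail_term0 s n : tail_term 0 s n = b 0 n.+1 * natpow n.+1 (- s).
Proof. by rewrite /tail_term addn0 /zdiff /= lpow0_natpow. Qed.

Lemma abel_entire_series s : 0 < complex.Re s ->
  cconv (fun N => \sum_(0 <= n < N) b 0 n.+1 * natpow n.+1 (- s)) (abel_entire s).
Proof.
move=> s0.
have main k : 2 <= complex.Re s + k%:R ->
    cconv (fun N => \sum_(0 <= n < N) tail_term 0 s n) (abel_cont k s).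
  move=> ks.
  have -> : (fun N => \sum_(0 <= n < N) tail_term 0 s n) = (fun N =>
      \sum_(j < k) (b j.+1 j.+1 * zdiff j s 1 - b j.+1 (N.+1 + j) * zdiff j s N.+1%:R)
      + \sum_(0 <= n < N) tail_term k s n).
    apply/funext => N; elim: k {ks} => [|k IHk]; first by rewrite big_ord0 add0r.
    by rewrite IHk big_ord_recr/= abel_step addrA.
  apply: cconvD (cconv_tail ks).
  rewrite /head_sum; elim: k {ks} => [|k IHk].
    rewrite big_ord0; under eq_fun do rewrite big_ord0; exact: cconv_cst.
  rewrite big_ord_recr/=; under eq_fun do rewrite big_ord_recr/=.
  apply: cconvD IHk _; rewrite -[X in cconv _ X]subr0.
  apply: cconvB; first exact: cconv_cst.
  apply: cconv_boundary.
  have : 0 <= (k%:R : R) by []; lra.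
have := main 2%N; rewrite -abel_entireE; last lra.
move=> /(_ ltac:(lra)).
by under eq_fun do under eq_bigr do rewrite tail_term0.
Qed.

Lemma abel_entire_continuation : entire_continuation (b 0) abel_entire.
Proof.
split; first exact: abel_entire_entire.
move=> s s1; have h : cconv _ (abel_entire s) := @abel_entire_series s ltac:(lra).
apply/cvgrPdist_le => e e0.
have [er er0 eE] : exists2 er : R, 0 < er & e = (er%:C)%C.
  exists (complex.Re e); first by move: e0; rewrite ltcE /= => /andP[].
  by move: e0; rewrite ltcE /= => /andP[/eqP i0 _]; apply: complex_eqP.
move/cvgrPdist_le: h => /(_ _ er0); apply: filterS => n.
rewrite sub0r normrN ger0_norm ?cabs_ge0// => h.
by rewrite eE normc_cabs lecR cabs_distC.
Qed.

(** The derivative of y ^ (- s) is at most |s| y ^ (- Re s - 1) in absolute value, which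
is the derivative of - |s| / Re s * y ^ (- Re s).  This form of the bound
telescopes. *)
Lemma cabs_zdiff1_le s (x : R) : 0 < complex.Re s -> 0 < x ->
  cabs (zdiff 1 s x) <= 2 * (cabs s / complex.Re s) *
    (expR (- complex.Re s * ln x) - expR (- complex.Re s * ln (x + 1))).
Proof.
move=> s0 x0.
pose w y : R := - (cabs s / complex.Re s) * expR (- complex.Re s * ln y).
have hw (y : R) : 0 < y -> is_derive y 1 w (cabs s * (y^-1 * expR (- complex.Re s * ln y))).
  move=> y0; have hl := is_derive1_ln y0.
  have h1 : is_derive y 1 (fun v : R => - complex.Re s * ln v) (- complex.Re s * y^-1).
    refine (is_derive_val (is_derive_mulR (is_derive_cst (- complex.Re s) y 1) hl) _).
    by rewrite mul0r add0r.
  have h2 := @is_derive_compR _ expR (fun v : R => - complex.Re s * ln v) y _ _ (is_derive_expR _) h1.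
  refine (is_derive_val (is_derive_mulR (is_derive_cst (- (cabs s / complex.Re s)) y 1) h2) _).
  by rewrite mul0r add0r /=; field; rewrite !gt_eqF.
have hf (y : R) : 0 < y -> cderiv (lpow 0 s) y (- s * lpow 0 (s + 1) y).
  by move=> y0; apply: cderiv_val; [exact: cderiv_lpow|rewrite mul0r add0r].
have hM (y : R) : 0 < y -> cabs (- s * lpow 0 (s + 1) y) = cabs s * (y^-1 * expR (- complex.Re s * ln y)).
  move=> y0; rewrite cabsM cabsN lpowD1// cabsM cabs_real ger0_norm ?invr_ge0 ?ltW//.
  by rewrite cabs_lpow expr0 mul1r.
have cmp (u du : R -> R) : (forall y : R, 0 < y -> is_derive y 1 u (du y)) ->
    (forall y, 0 < y -> `|du y| <= cabs s * (y^-1 * expR (- complex.Re s * ln y))) ->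
    `|u (x + 1) - u x| <= w (x + 1) - w x.
  move=> hu hdu; apply: (@is_derive_compare_le _ u du w
     (fun y => cabs s * (y^-1 * expR (- complex.Re s * ln y)))).
  - by rewrite lerDl.
  - by move=> y yx; apply: hu; lra.
  - by move=> y yx; apply: hw; lra.
  - by move=> y yx; apply: hdu; lra.
rewrite /zdiff /= (le_trans (cabs_le_ReIm _))//.
have -> : 2 * (cabs s / complex.Re s) *
    (expR (- complex.Re s * ln x) - expR (- complex.Re s * ln (x + 1))) =
  (w (x + 1) - w x) + (w (x + 1) - w x) by rewrite /w; ring.
rewrite lerD//.
  rewrite ReD ReN; apply: (cmp (fun y => complex.Re (lpow 0 s y)) (fun y => complex.Re (- s * lpow 0 (s + 1) y))).
    by move=> y /hf[].
  by move=> y y0; rewrite -hM// normr_Re_cabs.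
rewrite ImD ImN; apply: (cmp (fun y => complex.Im (lpow 0 s y)) (fun y => complex.Im (- s * lpow 0 (s + 1) y))).
  by move=> y /hf[].
by move=> y y0; rewrite -hM// normr_Im_cabs.
Qed.

(** One summation by parts between N and N', then N' tends to infinity. *)
Lemma abel_entire_partial_sum : exists2 B : R, 0 <= B &
  forall s N, 0 < complex.Re s ->
  cabs (abel_entire s - \sum_(0 <= n < N) b 0 n.+1 * natpow n.+1 (- s)) <=
    B * (1 + cabs s / complex.Re s) * expR (- complex.Re s * ln N.+1%:R).
Proof.
have [B B0 hB] := b_bounded 1.
exists (2 * B) => [|s N s0]; first by rewrite mulr_ge0.
pose g n := expR (- complex.Re s * ln n.+1%:R).
pose S N := \sum_(0 <= n < N) tail_term 0 s n.
have SE n : S n = \sum_(0 <= i < n) b 0 i.+1 * natpow i.+1 (- s).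
  by apply: eq_bigr => i _; rewrite tail_term0.
rewrite -SE.
have hS : cconv S (abel_entire s).
  by rewrite (_ : S = fun n => \sum_(0 <= i < n) b 0 i.+1 * natpow i.+1 (- s));
    [exact: abel_entire_series|apply/funext].
apply: (cconv_le (cconvB hS (cconv_cst (S N)))).
exists N => // N' /= NN'.
have q0 : 0 <= cabs s / complex.Re s by rewrite divr_ge0 ?cabs_ge0 ?ltW.
have gle n m : (n <= m)%N -> g m <= g n.
  move=> nm; rewrite ler_expR !mulNr lerN2; apply: ler_wpM2l; first exact: ltW.
  by rewrite ler_ln ?posrE ?ltr0n// ler_nat ltnS.
have f1 n : cabs (zdiff 0 s n.+1%:R) = g n.
  by rewrite /zdiff/= cabs_lpow expr0 mul1r.
have sumd : cabs (\sum_(N <= n < N') tail_term 1 s n) <=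
    B * (2 * (cabs s / complex.Re s) * (g N - g N')).
  rewrite (le_trans (cabs_sum _ _ _))//.
  apply: (@le_trans _ _ (\sum_(N <= n < N') B * (2 * (cabs s / complex.Re s)) * (g n - g n.+1))).
    apply: ler_sum => n _; rewrite cabsM -mulrA ler_pM ?cabs_ge0//.
    by have := @cabs_zdiff1_le s n.+1%:R s0; rewrite natr1; apply; rewrite ltr0n.
  rewrite -big_distrr/= (telescope_sumr_eq (fun n => - g n)) => [|//|n _]; last by ring.
  by rewrite le_eqVlt; apply/orP; left; apply/eqP; ring.
have -> : S N' - S N = b 1 N.+1 * zdiff 0 s N.+1%:R - b 1 N'.+1 * zdiff 0 s N'.+1%:R
   + \sum_(N <= n < N') tail_term 1 s n.
  rewrite /S (abel_step 0 s N') (abel_step 0 s N) !addn0 (big_cat_nat (leq0n N) NN')/=; ring.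
have h1 : cabs (b 1 N.+1 * zdiff 0 s N.+1%:R) <= B * g N.
  by rewrite cabsM f1 ler_wpM2r ?expR_ge0.
have h2 : cabs (b 1 N'.+1 * zdiff 0 s N'.+1%:R) <= B * g N'.
  by rewrite cabsM f1 ler_wpM2r ?expR_ge0.
rewrite (le_trans (cabsD _ _))//.
apply: (le_trans (lerD (le_trans (cabsB _ _) (lerD h1 h2)) sumd)).
have := gle _ _ NN'; have : 0 <= g N' by exact: expR_ge0.
rewrite -/(g N) => g0 gg.
have := mulr_ge0 B0 q0; set q := cabs s / _ in q0 *; nra.
Qed.

End continuation.

(** * Mean values of Dirichlet polynomials *)
Section chebyshev.
Context {R : realType}.
Local Notation mu := (@lebesgue_measure R).

(** Bounding the square of a Dirichlet polynomial in mean only requires the variation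
of an antiderivative, known in closed form. *)
Lemma chebyshev_antiderivative (f G : R -> R) (a b lam : R)
    (E : set (measurableTypeR R)) : a < b -> 0 < lam ->
  continuous f -> (forall t, 0 <= f t) -> (forall t : R, is_derive t 1 G (f t)) ->
  measurable E -> (forall t, E t -> a <= t <= b /\ lam <= f t) ->
  (mu E <= ((G b - G a) / lam)%:E)%E.
Proof.
move=> ab lam0 cf f0 hG mE hE.
have mf : measurable_fun [set: measurableTypeR R] (f : measurableTypeR R -> R).
  exact: continuous_measurable_fun.
have cG : continuous G.
  move=> t; apply: differentiable_continuous; apply/derivable1_diffP.
  by have [] := hG t.
have iG : (\int[mu]_(x in `[a, b]) (f x)%:E = (G b)%:E - (G a)%:E)%E.
  apply: continuous_FTC2 => //.
  - exact: continuous_subspaceT.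
  - split.
    + by move=> x _; have [] := hG x.
    + exact: cvg_at_right_filter (cG a).
    + exact: cvg_at_left_filter (cG b).
  - by move=> x _; rewrite derive1E; have [_ ->] := hG x.
have h : (lam%:E * mu E <= \int[mu]_(x in `[a, b]) (f x)%:E)%E.
  rewrite -integral_cst//.
  apply: (@le_trans _ _ (\int[mu]_(x in E) (f x)%:E)%E).
    apply: ge0_le_integral => //=.
    - by move=> x _; rewrite lee_fin ltW.
    - by apply/measurable_EFinP; exact: measurable_funTS.
    - by move=> x /hE[_]; rewrite lee_fin.
  apply: ge0_subset_integral => //=.
  - by apply/measurable_EFinP; exact: measurable_funTS.
  - by move=> x _; rewrite lee_fin.
  - by move=> x /hE[xab _]; rewrite /= in_itv/=.
rewrite EFinM lee_pdivlMr// muleC EFinB -iG; exact: h.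
Qed.

End chebyshev.

Section dirichlet_polynomials.
Context {R : realType}.
Local Notation mu := (@lebesgue_measure R).

(** The modulus of n ^ (- 1/2 - it); also equal to 1 at n = 0, where ln is 0. *)
Definition inv_sqrt (n : nat) : R := expR (- (1 / 2) * ln n%:R).

Lemma inv_sqrt_gt0 n : 0 < inv_sqrt n. Proof. exact: expR_gt0. Qed.

Lemma sqr_inv_sqrt n : (0 < n)%N -> inv_sqrt n ^+ 2 = n%:R^-1.
Proof.
move=> n0; rewrite /inv_sqrt -expRM_natl mulrA (_ : 2%:R * - (1 / 2) = -1 :> R); last by field.
by rewrite mulN1r expRN lnK// posrE ltr0n.
Qed.

Lemma le_inv_sqrt m n : (0 < m)%N -> (m <= n)%N -> inv_sqrt n <= inv_sqrt m.
Proof.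
move=> m0 mn; rewrite /inv_sqrt ler_expR !mulNr lerN2; apply: ler_wpM2l; first lra.
by rewrite ler_ln ?posrE ?ltr0n// ?(leq_trans m0)// ler_nat.
Qed.

(** For m < n one has ln n - ln m >= (n - m) / n = 1 / (1 + m / (n - m)), and
m <= sqrt (n m). *)
Lemma inv_dist_ln_le m n : (0 < m)%N -> (0 < n)%N ->
  inv_sqrt n * inv_sqrt m * `|ln n%:R - ln m%:R|^-1 <=
    inv_sqrt n * inv_sqrt m + `|n%:R - m%:R|^-1.
Proof.
wlog mn : m n / (m <= n)%N => [hw m0 n0|m0 n0].
  case: (leqP m n) => [/hw|/ltnW/hw]; first exact.
  by rewrite [inv_sqrt m * inv_sqrt n]mulrC distrC [`|m%:R - _|]distrC; apply.
have r0 := mulr_gt0 (inv_sqrt_gt0 n) (inv_sqrt_gt0 m).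
move: mn; rewrite leq_eqVlt => /predU1P[->|mn].
  by rewrite !subrr normr0 invr0 mulr0 addr0 mulr_ge0// ltW// inv_sqrt_gt0.
have mR : 0 < (m%:R : R) by rewrite ltr0n.
have nR : 0 < (n%:R : R) by rewrite ltr0n.
have mnR : (m%:R : R) < n%:R by rewrite ltr_nat.
rewrite [`|n%:R - m%:R|]gtr0_norm ?subr_gt0//.
have dln : (n%:R - m%:R) / n%:R <= ln n%:R - ln m%:R :> R.
  rewrite -[leRHS]opprB lerNr -ln_div ?posrE//.
  have -> : m%:R / n%:R = 1 + (m%:R / n%:R - 1) :> R by ring.
  apply: (le_trans (le_ln1Dx _)); first by rewrite ltrBrDl subrr divr_gt0.
  by rewrite mulrBl opprB divff ?gt_eqF.
have dp : 0 < (n%:R - m%:R) / n%:R :> R by rewrite divr_gt0// subr_gt0.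
rewrite gtr0_norm; last exact: lt_le_trans dln.
apply: (@le_trans _ _ (inv_sqrt n * inv_sqrt m * (n%:R / (n%:R - m%:R)))).
  by rewrite ler_pM2l// -[n%:R / _]invrK invf_div lef_pV2 ?posrE// (lt_le_trans dp).
have -> : n%:R / (n%:R - m%:R) = 1 + m%:R * (n%:R - m%:R)^-1 :> R.
  by field; rewrite subr_eq0 gt_eqF.
rewrite mulrDr mulr1 lerD2l mulrA ler_piMl ?invr_ge0 ?subr_ge0 ?(ltW mnR)//.
have := le_inv_sqrt m0 (ltnW mn); have := sqr_inv_sqrt m0 => hm hle.
have : inv_sqrt n * inv_sqrt m * m%:R <= inv_sqrt m ^+ 2 * m%:R.
  by rewrite ler_pM2r// expr2 ler_pM2r ?inv_sqrt_gt0.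
by rewrite hm mulVf ?gt_eqF.
Qed.

Definition dpoly (a : nat -> R[i]) p q t : R[i] :=
  \sum_(p <= n < q) a n * natpow n (- (1 / 2 +i* t)%C).

Lemma natpow_half n t :
  natpow n (- (1 / 2 +i* t)%C) = (inv_sqrt n)%:C%C * cis (- ln n%:R * t) :> R[i].
Proof.
rewrite /natpow /cexp /inv_sqrt -/(cis _); congr (_%:C%C * cis _).
  by congr expR; rewrite /= mulr0 subr0.
by rewrite /=; ring.
Qed.

Lemma cderiv_cis (u t : R) : cderiv (fun v => cis (u * v)) t ((0 +i* u)%C * cis (u * t)).
Proof.
have hid : is_derive t 1 (fun z : R => z) 1 by exact: is_derive_id.
have hcst : is_derive t 1 (fun=> u) 0 by exact: is_derive_cst.
have hu : is_derive t 1 (fun v : R => u * v) u.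
  by refine (is_derive_val (is_derive_mulR hcst hid) _); rewrite mul0r add0r /= mulr1.
split => /=.
  refine (is_derive_val (@is_derive_compR _ cos (fun v => u * v) t _ _ (is_derive_cos _) hu) _).
  by ring.
refine (is_derive_val (@is_derive_compR _ sin (fun v => u * v) t _ _ (is_derive_sin _) hu) _).
by ring.
Qed.

Lemma cabs_conjc (z : R[i]) : cabs z^*%C = cabs z.
Proof. by case: z => x y; rewrite !cabsE/= sqrrN. Qed.

Lemma sqr_cabs_conj (z : R[i]) : cabs z ^+ 2 = complex.Re (z * z^*%C).
Proof. by rewrite sqr_cabs; case: z => x y /=; ring. Qed.

Lemma conjcM (z w : R[i]) : (z * w)^*%C = z^*%C * w^*%C.
Proof. exact: (rmorphM (@conjc R)). Qed.

Lemma conjc_sum (I : Type) (r : seq I) (F : I -> R[i]) :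
  (\sum_(i <- r) F i)^*%C = \sum_(i <- r) (F i)^*%C.
Proof. exact: (raddf_sum (@conjc R)). Qed.

Lemma conjc_cis (t : R) : (cis t)^*%C = cis (- t).
Proof. by rewrite /cis cosN sinN. Qed.

Lemma is_derive_sumR (I : eqType) (r : seq I) (F : I -> R -> R) (dF : I -> R) (t : R) :
  (forall i, i \in r -> is_derive t 1 (F i) (dF i)) ->
  is_derive t 1 (fun v => \sum_(i <- r) F i v) (\sum_(i <- r) dF i).
Proof.
elim: r => [|i r IHr] h.
  rewrite big_nil (_ : (fun v => _) = fun=> 0); first exact: is_derive_cst.
  by apply/funext => v; rewrite big_nil.
rewrite big_cons (_ : (fun v => _) = fun v => F i v + \sum_(j <- r) F j v); last first.
  by apply/funext => v; rewrite big_cons.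
apply: is_derive_addR; first by apply: h; rewrite mem_head.
by apply: IHr => j jr; apply: h; rewrite inE jr orbT.
Qed.

Lemma cderiv_sum (I : eqType) (r : seq I) (F : I -> R -> R[i]) (dF : I -> R[i]) (t : R) :
  (forall i, i \in r -> cderiv (F i) t (dF i)) ->
  cderiv (fun v => \sum_(i <- r) F i v) t (\sum_(i <- r) dF i).
Proof.
elim: r => [|i r IHr] h.
  rewrite big_nil (_ : (fun v => _) = fun=> 0); first exact: cderiv_cst.
  by apply/funext => v; rewrite big_nil.
rewrite big_cons (_ : (fun v => _) = fun v => F i v + \sum_(j <- r) F j v); last first.
  by apply/funext => v; rewrite big_cons.
apply: cderivD; first by apply: h; rewrite mem_head.
by apply: IHr => j jr; apply: h; rewrite inE jr orbT.
Qed.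

Section mean_square.
Variables (a : nat -> R[i]) (p q : nat).
Hypothesis p0 : (0 < p)%N.

Let c n : R[i] := a n * (inv_sqrt n)%:C%C.
Let u n m : R := - (ln n%:R - ln m%:R).

Let cabs_c n : cabs (c n) = cabs (a n) * inv_sqrt n.
Proof. by rewrite /c cabsM cabs_real gtr0_norm// inv_sqrt_gt0. Qed.

Let sqr_dpoly t : cabs (dpoly a p q t) ^+ 2 =
  \sum_(p <= n < q) \sum_(p <= m < q) complex.Re (c n * (c m)^*%C * cis (u n m * t)).
Proof.
rewrite sqr_cabs_conj /dpoly conjc_sum big_distrl/= Re_sum.
apply: eq_bigr => n _; rewrite big_distrr/= Re_sum; apply: eq_bigr => m _.
congr complex.Re; rewrite !natpow_half /c /u opprB addrC mulrDl cisD !conjcM conjc_cis conjc_real.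
by rewrite [- ln m%:R * t]mulNr opprK; ring.
Qed.

(* A primitive of the (n, m) term of the expanded square. *)
Let antider (n m : nat) (t : R) : R := if n == m then t * cabs (c n) ^+ 2
  else complex.Re (c n * (c m)^*%C * (0 +i* - (u n m)^-1)%C * cis (u n m * t)).

Let is_derive_antider (n m : nat) (t : R) : (p <= n)%N -> (p <= m)%N ->
  is_derive t 1 (antider n m) (complex.Re (c n * (c m)^*%C * cis (u n m * t))).
Proof.
move=> pn pm; rewrite /antider; have [->|nm] := eqVneq n m.
  have -> : u m m = 0 by rewrite /u subrr oppr0.
  rewrite mul0r cis0 mulr1 -sqr_cabs_conj.
  have hid : is_derive t 1 (fun z : R => z) 1 by exact: is_derive_id.
  have hcst : is_derive t 1 (fun=> cabs (c m) ^+ 2) 0 by exact: is_derive_cst.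
  by refine (is_derive_val (is_derive_mulR hid hcst) _); rewrite mulr0 addr0 /= mul1r.
have u0 : u n m != 0.
  rewrite /u oppr_eq0 subr_eq0; apply: contraNneq nm => h.
  have : n%:R = m%:R :> R.
    by apply: (@ln_inj R); rewrite ?posrE ?ltr0n ?(leq_trans p0).
  by move/eqP; rewrite eqr_nat.
have [h _] := cderivZ (c n * (c m)^*%C * (0 +i* - (u n m)^-1)%C) (cderiv_cis (u n m) t).
refine (is_derive_val h _); congr complex.Re.
rewrite -mulrA [(0 +i* - _)%C * _]mulrA (_ : (0 +i* - (u n m)^-1)%C * (0 +i* u n m)%C = 1) ?mul1r//.
by apply: complex_eqP; rewrite ?ReM ?ImM /= ?mul0r ?mulr0 ?addr0// sub0r mulNr opprK mulVf.
Qed.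

Let antider_le (n m : nat) (T : R) : 0 < T -> (p <= n < q)%N -> (p <= m < q)%N ->
  antider n m (2 * T) - antider n m T <=
   (if n == m then T * (cabs (a n) ^+ 2 / n%:R) else 0)
   + 2 * (cabs (a n) * inv_sqrt n * (cabs (a m) * inv_sqrt m))
   + (cabs (a n) ^+ 2 + cabs (a m) ^+ 2) * `|n%:R - m%:R|^-1.
Proof.
move=> T0 /andP[pn _] /andP[pm _].
have n0 : (0 < n)%N := leq_trans p0 pn; have m0 : (0 < m)%N := leq_trans p0 pm.
have an := cabs_ge0 (a n); have am := cabs_ge0 (a m).
have rn := inv_sqrt_gt0 n; have rm := inv_sqrt_gt0 m.
have d0 : 0 <= `|n%:R - m%:R : R|^-1 by rewrite invr_ge0.
rewrite /antider; have [<-|nm] := eqVneq n m.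
  rewrite cabs_c exprMn sqr_inv_sqrt// subrr normr0 invr0 mulr0 addr0.
  rewrite (_ : _ - _ = T * (cabs (a n) ^+ 2 / n%:R)); last by ring.
  by rewrite lerDl !mulr_ge0// ltW.
rewrite add0r -ReN -ReD -mulrBr.
apply: (le_trans (ler_norm _)); apply: (le_trans (normr_Re_cabs _)).
have hc : cabs (cis (u n m * (2 * T)) - cis (u n m * T)) <= 2.
  by rewrite (le_trans (cabsB _ _))// !cabs_cis; lra.
rewrite 3!cabsM cabs_conjc !cabs_c.
have -> : cabs (0 +i* - (u n m)^-1)%C = `|ln n%:R - ln m%:R|^-1.
  by rewrite cabsE/= expr0n add0r sqrtr_sqr normrN normfV /u normrN.
have hd := inv_dist_ln_le m0 n0.
set D := `|ln _ - _|^-1 in hd *; set d := `|_|^-1 in hd d0 *.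
have D0 : 0 <= D by rewrite /D invr_ge0.
apply: (@le_trans _ _ (cabs (a n) * inv_sqrt n * (cabs (a m) * inv_sqrt m) * D * 2)).
  by apply: ler_wpM2l => //; rewrite !mulr_ge0// ltW.
rewrite (_ : _ * D * 2 = 2 * (cabs (a n) * cabs (a m)) * (inv_sqrt n * inv_sqrt m * D)); last by ring.
apply: le_trans (ler_wpM2l _ hd) _; first by rewrite !mulr_ge0.
rewrite mulrDr lerD//; first by rewrite le_eqVlt; apply/orP; left; apply/eqP; ring.
apply: ler_wpM2r => //; have := sqr_ge0 (cabs (a n) - cabs (a m)); nra.
Qed.

Let continuous_sqr_dpoly : continuous (fun t => cabs (dpoly a p q t) ^+ 2).
Proof.
have hd (t : R) : cderiv (dpoly a p q) t (\sum_(p <= n < q)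
    a n * (inv_sqrt n)%:C%C * ((0 +i* - ln n%:R)%C * cis (- ln n%:R * t))).
  apply: cderiv_sum => n _.
  have -> : (fun t => a n * natpow n (- (1 / 2 +i* t)%C)) =
      (fun t => a n * (inv_sqrt n)%:C%C * cis (- ln n%:R * t)).
    by apply/funext => v; rewrite natpow_half mulrA.
  exact/cderivZ/cderiv_cis.
have cre : continuous (fun t => complex.Re (dpoly a p q t) : R).
  move=> t; apply: differentiable_continuous; apply/derivable1_diffP.
  by have [[]] := hd t.
have cim : continuous (fun t => complex.Im (dpoly a p q t) : R).
  move=> t; apply: differentiable_continuous; apply/derivable1_diffP.
  by have [_ []] := hd t.
have -> : (fun t => cabs (dpoly a p q t) ^+ 2) = (fun t =>
    complex.Re (dpoly a p q t) * complex.Re (dpoly a p q t) +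
    complex.Im (dpoly a p q t) * complex.Im (dpoly a p q t)).
  by apply/funext => t; rewrite sqr_cabs !expr2.
by move=> t; apply: cvgD; apply: cvgM; first [exact: cre|exact: cim].
Qed.

(** Expanding the square, the diagonal integrates to the first sum.  The terms with
n <> m contribute O(|a n a m| / (sqrt (n m) |ln n - ln m|)), which
[inv_dist_ln_le] splits into a rank one form and a Hilbert type form; the latter is
bounded with 2 |a n a m| <= |a n| ^ 2 + |a m| ^ 2. *)
Lemma dpoly_chebyshev (T lam : R) (E : set (measurableTypeR R)) : 0 < T -> 0 < lam ->
  measurable E -> (forall t, E t -> T <= t <= 2 * T /\ lam <= cabs (dpoly a p q t)) ->
  (mu E <=
   ((T * \sum_(p <= n < q) cabs (a n) ^+ 2 / n%:R
     + 2 * (\sum_(p <= n < q) cabs (a n) * inv_sqrt n) ^+ 2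
     + 4 * harmonic_sum q * \sum_(p <= n < q) cabs (a n) ^+ 2) / lam ^+ 2)%:E)%E.
Proof.
move=> T0 lam0 mE hE.
pose G t := \sum_(p <= n < q) \sum_(p <= m < q) antider n m t.
have hG (t : R) : is_derive t 1 G (cabs (dpoly a p q t) ^+ 2).
  rewrite sqr_dpoly; apply: is_derive_sumR => n; rewrite mem_index_iota => /andP[pn _].
  apply: is_derive_sumR => m; rewrite mem_index_iota => /andP[pm _].
  exact: is_derive_antider.
have hE2 t : E t -> T <= t <= 2 * T /\ lam ^+ 2 <= cabs (dpoly a p q t) ^+ 2.
  by move=> /hE[tT h]; split => //; rewrite lerXn2r// nnegrE ?cabs_ge0// ltW.
apply: le_trans (chebyshev_antiderivative _ _ continuous_sqr_dpoly _ hG mE hE2) _.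
- by lra.
- by rewrite exprn_gt0.
- by move=> t; rewrite sqr_ge0.
rewrite lee_fin ler_wpM2r// ?invr_ge0 ?sqr_ge0//.
rewrite /G -sumrB.
pose A n : R := cabs (a n) ^+ 2.
have A0 n : 0 <= A n by exact: sqr_ge0.
have inv n : (n < q)%N -> \sum_(p <= m < q) `|n%:R - m%:R : R|^-1 <= 2 * harmonic_sum q.
  move=> nq; apply: le_trans (sum_inv_dist_le nq).
  case: (leqP p q) => [pq|/ltnW qp]; last by rewrite big_geq// sumr_ge0// => i _; rewrite invr_ge0.
  rewrite [leRHS](big_cat_nat (leq0n p) pq)/= lerDr; apply: sumr_ge0 => i _.
  by rewrite invr_ge0.
apply: (@le_trans _ _ (\sum_(p <= n < q) \sum_(p <= m < q)
   ((if n == m then T * (cabs (a n) ^+ 2 / n%:R) else 0)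
   + 2 * (cabs (a n) * inv_sqrt n * (cabs (a m) * inv_sqrt m))
   + (cabs (a n) ^+ 2 + cabs (a m) ^+ 2) * `|n%:R - m%:R|^-1))).
  rewrite big_nat [leRHS]big_nat; apply: ler_sum => n nI.
  rewrite -sumrB big_nat [leRHS]big_nat; apply: ler_sum => m mI.
  exact: antider_le.
under eq_bigr do rewrite !big_split/=.
rewrite !big_split/=; apply: lerD; first apply: lerD.
- rewrite big_distrr/= big_nat [leRHS]big_nat; apply: ler_sum => n nI.
  rewrite (bigD1_seq n) ?iota_uniq ?mem_index_iota//= ?eqxx big1 ?addr0//.
  by move=> i; rewrite eq_sym => /negbTE ->.
- rewrite le_eqVlt; apply/orP; left; apply/eqP.
  rewrite expr2 big_distrl/= big_distrr/=; apply: eq_bigr => n _.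
  by rewrite !big_distrr/=; apply: eq_bigr => m _.
have half : \sum_(p <= n < q) \sum_(p <= m < q) A n * `|n%:R - m%:R|^-1 <=
    2 * harmonic_sum q * \sum_(p <= n < q) A n.
  rewrite big_distrr/= big_nat [leRHS]big_nat; apply: ler_sum => n /andP[_ nq].
  by rewrite -big_distrr/= mulrC ler_wpM2r// inv.
rewrite (_ : \sum_(p <= n < q) _ = \sum_(p <= n < q) \sum_(p <= m < q) A n * `|n%:R - m%:R|^-1
   + \sum_(p <= n < q) \sum_(p <= m < q) A n * `|n%:R - m%:R|^-1).
  rewrite (_ : 4 * _ * _ = 2 * harmonic_sum q * \sum_(p <= n < q) A n
     + 2 * harmonic_sum q * \sum_(p <= n < q) A n); last by rewrite /A; ring.
  exact: lerD.
rewrite [X in _ + X]exchange_big -big_split/=; apply: eq_bigr => n _.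
rewrite -big_split/=; apply: eq_bigr => m _.
by rewrite [`|m%:R - _|]distrC mulrDl.
Qed.

End mean_square.

End dirichlet_polynomials.

(** * Short and long sums *)
Section poly_vs_exp.
Context {R : realType}.

(** ln (d x) <= d x with d chosen so that B d = - ln r. *)
Lemma powR_geometric_bounded (B r : R) : 0 < B -> 0 < r < 1 ->
  exists2 C : R, 0 < C & forall M : nat, (1 + M%:R) `^ B * r ^+ M <= C.
Proof.
move=> B0 /andP[r0 r1].
pose c := - ln r; have c0 : 0 < c by rewrite oppr_gt0 ln_lt0// r0.
pose d := c / B; have d0 : 0 < d by rewrite divr_gt0.
exists (expR (c - B * ln d)) => [|M]; first exact: expR_gt0.
have x0 : 0 < 1 + M%:R :> R by rewrite ltr_pwDl.
rewrite /powR gt_eqF// -[r in r ^+ _]lnK ?posrE// -expRM_natl -expRD ler_expR.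
have : ln (d * (1 + M%:R)) <= d * (1 + M%:R).
  by apply/ltW/ln_sublinear; rewrite mulr_gt0.
rewrite lnM ?posrE// => h.
have : B * (ln d + ln (1 + M%:R)) <= B * (d * (1 + M%:R)) by rewrite ler_pM2l.
have -> : B * (d * (1 + M%:R)) = c * (1 + M%:R) by rewrite /d; field; rewrite gt_eqF.
by rewrite /c; lra.
Qed.

Lemma exists_pow_bracket (q y : R) : 1 < q -> 1 <= y ->
  exists n : nat, q ^+ n <= y < q ^+ n.+1.
Proof.
move=> q1 y1.
have [N hN] : exists N, y < q ^+ N.
  pose e := q - 1; have e0 : 0 < e by rewrite subr_gt0.
  have bern n : 1 + n%:R * e <= q ^+ n.
    elim: n => [|n IHn]; first by rewrite mul0r addr0 expr0.
    rewrite exprS -[n.+1%:R]natr1.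
    have : q * (1 + n%:R * e) <= q * q ^+ n by rewrite ler_pM2l// (lt_trans ltr01).
    have -> : q = 1 + e by rewrite /e; ring.
    have : 0 <= n%:R * e * e by rewrite !mulr_ge0// ltW.
    nra.
  exists (Num.truncn (y / e)).+1; apply: lt_le_trans (bern _).
  have := truncnS_gt (y / e); rewrite ltr_pdivrMr//; lra.
have [m hm hmin] := @ex_minnP (fun n => y < q ^+ n) (ex_intro _ N hN).
case: m hm hmin => [|m] hm hmin; first by move: hm; rewrite expr0; lra.
exists m; rewrite hm andbT leNgt; apply/negP => /hmin; by rewrite ltnn.
Qed.

End poly_vs_exp.

Section nu_hat_sums.
Context {R : realType}.
Notation q := (13 / 10 : R).
Local Notation a := (fun n => cabs (nu_hat n : R[i])).

Lemma pow3_gt0 k : (0 < 3 ^ k)%N. Proof. by rewrite expn_gt0. Qed.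

Lemma nu_hat_block : exists2 C : R, 0 < C & forall k,
  \sum_(3 ^ k <= n < 3 ^ k.+1) a n ^+ 2 <= C * (q ^+ 2) ^+ k.
Proof.
have [C C0 hC] := @nu_hat_mean_square R.
exists (C * q ^+ 2) => [|k]; first by rewrite mulr_gt0// exprn_gt0//; lra.
rewrite -mulrA -exprS; apply: le_trans (hC k.+1).
have h : (3 ^ k <= 3 ^ k.+1)%N by rewrite leq_exp2l.
by rewrite [leRHS](big_cat_nat (leq0n _) h)/= lerDr sumr_ge0// => i _; rewrite sqr_ge0.
Qed.

(** Cauchy-Schwarz on each block 3 ^ k <= n < 3 ^ k.+1, in the form
2 x y <= x ^ 2 / c + c y ^ 2 with c = q ^ k. *)
Lemma nu_hat_abs_sum : exists2 C : R, 0 < C & forall k,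
  \sum_(1 <= n < 3 ^ k) a n * inv_sqrt n <= C * q ^+ k.
Proof.
have [C C0 hC] := nu_hat_block.
pose D : R := C + 2.
have D0 : 0 < D by rewrite /D; lra.
exists (D / (3 / 10)) => [|k]; first by rewrite divr_gt0//; lra.
have qk j : 0 < q ^+ j by rewrite exprn_gt0//; lra.
elim: k => [|k IHk]; first by rewrite expn0 big_geq// mulr_ge0// ltW// divr_gt0//; lra.
have h : (3 ^ k <= 3 ^ k.+1)%N by rewrite leq_exp2l.
rewrite (big_cat_nat (pow3_gt0 k) h)/=.
have blk : \sum_(3 ^ k <= n < 3 ^ k.+1) a n * inv_sqrt n <= D * q ^+ k.
  apply: (@le_trans _ _ (\sum_(3 ^ k <= n < 3 ^ k.+1)
      ((q ^+ k)^-1 * a n ^+ 2 + q ^+ k * (3 ^ k)%:R^-1))).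
    rewrite big_nat [leRHS]big_nat; apply: ler_sum => n /andP[kn _].
    have n0 : (0 < n)%N := leq_trans (pow3_gt0 k) kn.
    have hn : inv_sqrt n ^+ 2 <= ((3 ^ k)%:R : R)^-1.
      by rewrite sqr_inv_sqrt// lef_pV2 ?posrE ?ltr0n ?pow3_gt0// ler_nat.
    apply: (@le_trans _ _ ((q ^+ k)^-1 * a n ^+ 2 + q ^+ k * inv_sqrt n ^+ 2)); last first.
      by rewrite lerD2l ler_pM2l.
    have := sqr_ge0 (a n - q ^+ k * inv_sqrt n) => sq.
    have an : 0 <= a n by exact: cabs_ge0.
    have rn := @inv_sqrt_gt0 R n.
    have i0 : 0 < (q ^+ k)^-1 by rewrite invr_gt0.
    have : 0 <= (q ^+ k)^-1 * (a n - q ^+ k * inv_sqrt n) ^+ 2 by rewrite mulr_ge0// ltW.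
    have -> : (q ^+ k)^-1 * (a n - q ^+ k * inv_sqrt n) ^+ 2 =
      (q ^+ k)^-1 * a n ^+ 2 + q ^+ k * inv_sqrt n ^+ 2 - 2 * (a n * inv_sqrt n).
      by field; rewrite gt_eqF.
    have : 0 <= a n * inv_sqrt n by rewrite mulr_ge0// ltW.
    lra.
  rewrite big_split/= -big_distrr/= sumr_const_nat.
  have -> : (3 ^ k.+1 - 3 ^ k = 2 * 3 ^ k)%N by rewrite expnS; lia.
  rewrite -[(_ * _) *+ _]mulr_natr natrM.
  have -> : q ^+ k / (3 ^ k)%:R * (2 * (3 ^ k)%:R) = 2 * q ^+ k.
    by field; rewrite pnatr_eq0 -lt0n pow3_gt0.
  rewrite /D [leRHS]mulrDl lerD2r ler_pdivrMl//.
  by apply: le_trans (hC k) _; rewrite -exprM mulnC exprM expr2 mulrCA.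
apply: (le_trans (lerD IHk blk)).
by rewrite exprS; have := mulr_gt0 D0 (qk k); nra.
Qed.

(** The block 3 ^ m <= n < 3 ^ m.+1 contributes O((q ^ 2 / 3) ^ m), which is
O(q ^ (- 2 m)) because q ^ 4 < 3; the geometric series is summed by
telescoping. *)
Lemma nu_hat_weighted_tail : exists2 C : R, 0 < C & forall k m, (k <= m)%N ->
  \sum_(3 ^ k <= n < 3 ^ m) a n ^+ 2 / n%:R <= C * (q ^+ 2)^-1 ^+ k.
Proof.
have [C C0 hC] := nu_hat_block.
have q2 : q ^+ 2 = 169 / 100 by rewrite expr2; field.
pose p : R := 100 / 169.
have pE : (q ^+ 2)^-1 = p by rewrite q2 /p; field.
exists (C * (169 / 69)) => [|k m km]; first by rewrite mulr_gt0//; lra.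
rewrite pE.
have pk j : 0 < p ^+ j by rewrite exprn_gt0// /p; lra.
suff : \sum_(3 ^ k <= n < 3 ^ m) a n ^+ 2 / n%:R <= C * (169 / 69) * (p ^+ k - p ^+ m).
  move=> h; apply: le_trans h _; apply: ler_wpM2l; first by rewrite mulr_ge0// ltW//; lra.
  by rewrite gerBl ltW.
elim: m km => [|m IHm]; first by rewrite leqn0 => /eqP ->; rewrite big_geq// subrr mulr0.
rewrite leq_eqVlt => /predU1P[->|]; first by rewrite big_geq// subrr mulr0.
rewrite ltnS => km.
have h1 : (3 ^ k <= 3 ^ m)%N by rewrite leq_exp2l.
have h2 : (3 ^ m <= 3 ^ m.+1)%N by rewrite leq_exp2l.
rewrite (big_cat_nat h1 h2)/=.
have blk : \sum_(3 ^ m <= n < 3 ^ m.+1) a n ^+ 2 / n%:R <= C * p ^+ m.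
  apply: (@le_trans _ _ (\sum_(3 ^ m <= n < 3 ^ m.+1) a n ^+ 2 * (3 ^ m)%:R^-1)).
    rewrite big_nat [leRHS]big_nat; apply: ler_sum => n /andP[mn _].
    apply: ler_wpM2l; first exact: sqr_ge0.
    by rewrite lef_pV2 ?posrE ?ltr0n ?(leq_trans (pow3_gt0 m))// ler_nat.
  rewrite -big_distrl/=.
  apply: (@le_trans _ _ (C * (q ^+ 2) ^+ m * (3 ^ m)%:R^-1)).
    by apply: ler_wpM2r; [rewrite invr_ge0|exact: hC].
  rewrite -mulrA ler_pM2l// natrX -exprVn -exprMn lerXn2r ?nnegrE ?q2 /p; lra.
apply: le_trans (lerD (IHm km) blk) _.
rewrite exprS; have := pk m; rewrite {3}/p => pm.
have := mulr_gt0 C0 pm; nra.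
Qed.

End nu_hat_sums.

Section exceptional.
Context {R : realType}.
Local Notation mu := (@lebesgue_measure R).
Notation q := (13 / 10 : R).

Definition nu_zeta : R[i] -> R[i] := abel_entire twisted_coef.

Lemma nu_zeta_continuation : entire_continuation nu_hat nu_zeta.
Proof.
have -> : nu_hat = twisted_coef 0 :> (nat -> R[i]) by apply/funext => n; exact: nu_hatE.
exact: abel_entire_continuation (@twisted_coef_bounded R) (@twisted_coefB R).
Qed.

(** The error O(|s| / sqrt N) of the partial sum up to N is bounded once N exceeds
T ^ 2. *)
Lemma nu_zeta_partial_sum : exists2 B : R, 0 < B & forall T t M, 2 <= T ->
  T <= t <= 2 * T -> T ^+ 2 <= (3 ^ M)%:R ->
  cabs (nu_zeta (1 / 2 +i* t)%C - dpoly nu_hat 1 (3 ^ M) t) <= B.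
Proof.
have [B B0 hB] := abel_entire_partial_sum (@twisted_coef_bounded R) (@twisted_coefB R).
exists (5 * B + 1) => [|T t M T2 tT TM]; first lra.
have := hB (1 / 2 +i* t)%C (3 ^ M).-1 ltac:(rewrite /=; lra).
rewrite prednK ?pow3_gt0//.
have -> : \sum_(0 <= n < (3 ^ M).-1) twisted_coef 0 n.+1 * natpow n.+1 (- (1 / 2 +i* t)%C) =
   dpoly nu_hat 1 (3 ^ M) t.
  rewrite /dpoly -[in RHS](prednK (pow3_gt0 M)) big_add1/=.
  by apply: eq_bigr => i _; rewrite nu_hatE.
move=> h; apply: (le_trans h).
rewrite [complex.Re _]/= -/(inv_sqrt _).
have hs : cabs (1 / 2 +i* t)%C <= 1 / 2 + t.
  by rewrite (le_trans (cabs_le_ReIm _))//= !ger0_norm; lra.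
have r0 := inv_sqrt_gt0 (3 ^ M) : 0 < inv_sqrt (3 ^ M) :> R.
have rT : inv_sqrt (3 ^ M) * T <= 1.
  have h2 : (inv_sqrt (3 ^ M) * T) ^+ 2 <= 1.
    rewrite exprMn sqr_inv_sqrt ?pow3_gt0// ler_pdivrMl ?mulr1 ?ltr0n ?pow3_gt0//.
  by move: h2; rewrite expr_le1// mulr_ge0 ?ltW//; lra.
have s0 := cabs_ge0 (1 / 2 +i* t)%C.
apply: (@le_trans _ _ (B * (2 + 4 * T) * inv_sqrt (3 ^ M))).
  by apply: ler_wpM2r; [exact: ltW|apply: ler_wpM2l => //; lra].
have : B * (2 + 4 * T) * inv_sqrt (3 ^ M) <= B * 5 by rewrite -mulrA ler_wpM2l//; nra.
lra.
Qed.

End exceptional.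

(** * The exceptional set *)
Section exceptional_bound.
Context {R : realType}.
Local Notation mu := (@lebesgue_measure R).
Local Notation q := (13 / 10 : R).
Local Notation L := (@nu_zeta R).

Definition nu_zeta_half (t : R) : R := cabs (L (1 / 2 +i* t)%C).

Lemma cabs_dist (z w : R[i]) : `|cabs z - cabs w| <= cabs (z - w).
Proof.
have h1 := cabsD (z - w) w; have h2 := cabsD (w - z) z.
rewrite !subrK in h1 h2; rewrite (cabs_distC w z) in h2.
by rewrite ler_norml; lra.
Qed.

Lemma continuous_nu_zeta_half : continuous nu_zeta_half.
Proof.
move=> t; apply/cvgrPdist_le => e e0.
have [d hd] := abel_entire_cdiff (@twisted_coef_bounded R) (@twisted_coefB R) (1 / 2 +i* t)%C.
have [K K0 hK] := cdiff_lipschitz hd.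
have K1 : 0 < K + 1 by lra.
near=> v.
have hv : `|t - v| < Num.min 1 (e / (K + 1)).
  near: v; apply: cvgr_dist_lt; first exact: cvg_id.
  by rewrite lt_min ltr01 divr_gt0.
move: hv; rewrite lt_min => /andP[v1 ve].
have hh : cabs (0 +i* (v - t))%C = `|t - v|.
  by rewrite cabsE/= expr0n add0r sqrtr_sqr distrC.
have := hK (0 +i* (v - t))%C; rewrite hh => /(_ (ltW v1)).
have -> : (1 / 2 +i* t)%C + (0 +i* (v - t))%C = (1 / 2 +i* v)%C.
  by apply: complex_eqP; rewrite ?ReD ?ImD /= ?addr0// addrC subrK.
move=> h; rewrite distrC; apply: (le_trans (cabs_dist _ _)); apply: (le_trans h).
by move: ve; rewrite ltr_pdivlMr// => ve; have := normr_ge0 (t - v); nra.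
Unshelve. all: by end_near. Qed.

Lemma measurable_large_values (A : R) :
  measurable ([set t : R | ln t `^ A < nu_zeta_half t] : set (measurableTypeR R)).
Proof.
have mf : measurable_fun [set: measurableTypeR R]
    ((fun t => nu_zeta_half t - ln t `^ A) : measurableTypeR R -> R).
  apply: measurable_funB.
    exact: continuous_measurable_fun continuous_nu_zeta_half.
  exact: measurableT_comp (@measurable_powR R A) (@measurable_ln R).
rewrite (_ : [set t | _] = (fun t => nu_zeta_half t - ln t `^ A) @^-1` `]0, +oo[%classic).
  by rewrite -[X in measurable X]setTI; exact: mf.
by apply/seteqP; split => t; rewrite /= in_itv/= andbT subr_gt0.
Qed.

Lemma exceptional_setE A T :
  exceptional_set L A T = `[T, 2 * T]%classic `&` [set t | ln t `^ A < nu_zeta_half t].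
Proof.
apply/seteqP; split => t; rewrite /exceptional_set /= in_itv/=; first by case.
by case.
Qed.

Lemma measurable_exceptional_set A T :
  measurable (exceptional_set L A T : set (measurableTypeR R)).
Proof.
by rewrite exceptional_setE; apply: measurableI => //; exact: measurable_large_values.
Qed.

Lemma exceptional_measure_le_length A T : 0 < T -> (mu (exceptional_set L A T) <= T%:E)%E.
Proof.
move=> T0.
have e : (mu `[T, (2 * T)%R]%classic = T%:E)%E.
  rewrite lebesgue_measure_itv/= lte_fin ltr_pMl// ltr1n/= -EFinB; congr EFin; ring.
rewrite -[leRHS]e; apply: le_measure; rewrite ?inE//.
- exact: measurable_exceptional_set.
- by move=> t; rewrite exceptional_setE => -[].
Qed.

Lemma cabs_dpoly_le (p k : nat) t : cabs (dpoly nu_hat p k t) <=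
  \sum_(p <= n < k) cabs (nu_hat n : R[i]) * inv_sqrt n.
Proof.
rewrite (le_trans (cabs_sum _ _ _))//; apply: ler_sum => n _.
by rewrite cabsM natpow_half cabsM cabs_cis mulr1 cabs_real gtr0_norm// inv_sqrt_gt0.
Qed.

Lemma dpoly_cat (p k m : nat) t : (p <= k)%N -> (k <= m)%N ->
  dpoly nu_hat p m t = dpoly nu_hat p k t + dpoly nu_hat k m t :> R[i].
Proof. by move=> pk km; rewrite /dpoly (big_cat_nat pk km). Qed.

Lemma powR4 (l A : R) : l `^ (4 * A) = (l `^ A) ^+ 4.
Proof. by rewrite mulrC powRrM -powR_mulrn// powR_ge0. Qed.

(** The square of the left side is O((1 + M) ^ (2 + 4 A) q ^ (4 M)), as ln T <= 1 + M,
and q ^ (4 M) = 3 ^ M (q ^ 4 / 3) ^ M is at most 3 T ^ 2 times a decaying geometric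
sequence. *)
Lemma off_diagonal_saving A : 0 < A -> exists2 C : R, 0 < C & forall T M, 2 <= T ->
  T ^+ 2 <= 3 ^+ M <= 3 * T ^+ 2 ->
  (1 + M%:R) * (q ^+ 2) ^+ M * (ln T `^ A) ^+ 2 <= C * T.
Proof.
move=> A0; pose r : R := q ^+ 4 / 3.
have q4 : q ^+ 4 = 169 / 100 * (169 / 100) by rewrite !exprS expr0; field.
have r01 : 0 < r < 1 by rewrite /r q4; lra.
have B0 : 0 < 2 + 4 * A by lra.
have [C C0 hC] := powR_geometric_bounded B0 r01.
exists (1 + 3 * C) => [|T M T2 /andP[TM MT]]; first lra.
have x0 : 0 < 1 + M%:R :> R by rewrite ltr_pwDl.
have l0 : 0 < ln T by rewrite ln_gt0//; lra.
have lM : ln T <= 1 + M%:R.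
  have h : ln (T ^+ 2) <= ln (3 ^+ M) by rewrite ler_ln ?posrE ?exprn_gt0//; lra.
  rewrite !lnXn// in h; try lra.
  have h3 : ln (3 : R) <= 2.
    by rewrite (_ : 3 = 1 + 2 :> R); [apply: le_ln1Dx; lra|ring].
  move: h; rewrite -[ln T *+ 2]mulr_natr -[ln 3 *+ M]mulr_natr => h.
  have : 0 <= (M%:R : R) by []; nra.
set y := ln T `^ A.
have y4 : y ^+ 4 <= (1 + M%:R) `^ (4 * A).
  by rewrite -powR4; apply: ge0_ler_powR; rewrite ?nnegrE; lra.
have qM : (q ^+ 4) ^+ M = 3 ^+ M * r ^+ M.
  by rewrite -exprMn /r; congr (_ ^+ M); field.
have sq : ((1 + M%:R) * (q ^+ 2) ^+ M * y ^+ 2) ^+ 2 <= ((1 + 3 * C) * T) ^+ 2.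
  have -> : ((1 + M%:R) * (q ^+ 2) ^+ M * y ^+ 2) ^+ 2 =
      (1 + M%:R) ^+ 2 * (3 ^+ M * r ^+ M) * y ^+ 4.
    have e1 : ((q ^+ 2) ^+ M) ^+ 2 = (q ^+ 4) ^+ M by rewrite -!exprM mulnCA mulnC.
    have e2 : (y ^+ 2) ^+ 2 = y ^+ 4 by rewrite -exprM.
    by rewrite -qM -e1 -e2 -!exprMn.
  have r0 : 0 < r by case/andP: r01.
  apply: (@le_trans _ _ (3 * T ^+ 2 * ((1 + M%:R) `^ (2 + 4 * A) * r ^+ M))).
    rewrite powRD; last by rewrite gt_eqF ?implybT//; lra.
    rewrite (powR_mulrn 2 (ltW x0)).
    rewrite (_ : _ ^+ 2 * _ * _ = 3 ^+ M * ((1 + M%:R) ^+ 2 * y ^+ 4 * r ^+ M)); last by ring.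
    apply: ler_pM => //.
      by rewrite !mulr_ge0 ?exprn_ge0 ?powR_ge0// ltW.
    by apply: ler_wpM2r; [rewrite exprn_ge0// ltW|apply: ler_wpM2l => //; rewrite sqr_ge0].
  apply: (@le_trans _ _ (3 * T ^+ 2 * C)).
    by apply: ler_wpM2l => //; rewrite mulr_ge0 ?sqr_ge0.
  rewrite exprMn [3 * _ * C]mulrAC; apply: ler_wpM2r; [exact: sqr_ge0|nra].
have C0' : 0 <= (1 + 3 * C) * T by rewrite mulr_ge0//; lra.
have l0' : 0 <= (1 + M%:R) * (q ^+ 2) ^+ M * y ^+ 2.
  by apply: mulr_ge0; [apply: mulr_ge0; [exact: ltW|rewrite !exprn_ge0]|exact: sqr_ge0].
by move: sq; rewrite ler_pXn2r// nnegrE.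
Qed.

(** K is the last index for which the short sum stays below a quarter of (ln T) ^ A.
So does the error of the partial sum, as soon as (ln T) ^ A exceeds a constant;
below that constant the length of the interval is a sufficient bound. *)
Lemma exceptional_measure_le (A : R) : 0 < A -> exists2 C : R, 0 < C & forall T, 2 <= T ->
  (mu (exceptional_set L A T) <= (C * (T / ln T `^ (4 * A)))%:E)%E.
Proof.
move=> A0.
have [B B0 hB] := @nu_zeta_partial_sum R.
have [C1 C10 hC1] := @nu_hat_abs_sum R.
have [C2 C20 hC2] := @nu_hat_weighted_tail R.
have [Cv Cv0 hCv] := @nu_hat_mean_square R.
have [C3 C30 hC3] := off_diagonal_saving A0.
pose m0 : R := 4 * (B + C1); have m00 : 0 < m0 by rewrite /m0; lra.
pose D : R := 2 * C1 ^+ 2 + 8 * Cv.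
have D0 : 0 < D by rewrite /D ltr_wpDl// ?mulr_ge0 ?sqr_ge0//; lra.
pose C4 : R := C2 * (16 * C1 ^+ 2 * q ^+ 2) + D * C3.
have C40 : 0 < C4.
  by rewrite /C4 addr_gt0// !mulr_gt0// ?exprn_gt0//; lra.
exists (m0 ^+ 4 + 4 * C4) => [|T T2]; first by rewrite addr_gt0 ?exprn_gt0//; lra.
have T0 : 0 < T by lra.
have l0 : 0 < ln T by rewrite ln_gt0//; lra.
rewrite powR4; set y := ln T `^ A; have y0 : 0 < y by exact: powR_gt0.
have [ym|my] := ltP y m0.
  apply: le_trans (exceptional_measure_le_length A T0) _; rewrite lee_fin.
  rewrite mulrA ler_pdivlMr ?exprn_gt0// mulrC; apply: ler_wpM2r; first lra.
  apply: (@le_trans _ _ (m0 ^+ 4)); last by rewrite lerDl; lra.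
  by rewrite lerXn2r ?nnegrE ?ltW.
have [K /andP[Kl Ku]] : exists n : nat, q ^+ n <= y / (4 * C1) < q ^+ n.+1.
  apply: exists_pow_bracket; first lra.
  by rewrite ler_pdivlMr; [rewrite mul1r; move: my; rewrite /m0; lra|lra].
have [M' /andP[M1 M2]] : exists n : nat, 3 ^+ n <= T ^+ 2 < 3 ^+ n.+1.
  by apply: exists_pow_bracket; [lra|nra].
pose M := M'.+1.
have TM : T ^+ 2 <= 3 ^+ M <= 3 * T ^+ 2.
  by rewrite ltW//= /M exprS ler_pM2l.
have near_dpoly t : exceptional_set L A T t ->
    y - y / 4 < cabs (dpoly nu_hat 1 (3 ^ M) t).
  move=> [tT hL].
  have hyt : y <= ln t `^ A.
    apply: ge0_ler_powR; rewrite ?nnegrE ?ln_ge0//; try lra.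
    by rewrite ler_ln ?posrE; lra.
  have h := hB T t M T2 tT; rewrite natrX in h.
  have {}h := h (proj1 (andP TM)).
  have := cabsD (nu_zeta (1 / 2 +i* t)%C - dpoly nu_hat 1 (3 ^ M) t) (dpoly nu_hat 1 (3 ^ M) t).
  rewrite subrK => h2; move: my; rewrite /m0; lra.
have small k t : (k <= K)%N -> cabs (dpoly nu_hat 1 (3 ^ k) t) <= y / 4.
  move=> kK; apply: (le_trans (cabs_dpoly_le _ _ _)); apply: (le_trans (hC1 k)).
  have : q ^+ k <= q ^+ K by rewrite ler_weXn2l//; lra.
  move=> h; have := le_trans h Kl; rewrite ler_pdivlMr; last lra.
  lra.
(* If M <= K the whole partial sum is short, and nothing is exceptional. *)
have [MK|KM] := leqP M K.
  rewrite (_ : exceptional_set _ _ _ = set0); last first.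
    apply/seteqP; split => // t /near_dpoly h; have := small M t MK; lra.
  by rewrite measure0 lee_fin mulr_ge0 ?addr_ge0 ?exprn_ge0 ?divr_ge0 ?exprn_ge0
    ?(ltW T0) ?(ltW y0) ?(ltW m00)//; lra.
have p0 := pow3_gt0 K.
have KM3 : (3 ^ K <= 3 ^ M)%N by rewrite leq_exp2l// ltnW.
have sub t : exceptional_set L A T t ->
    T <= t <= 2 * T /\ y / 2 <= cabs (dpoly nu_hat (3 ^ K) (3 ^ M) t).
  move=> h; split; first by case: h.
  have := near_dpoly t h; rewrite (dpoly_cat t p0 KM3).
  have := small K t (leqnn K).
  have := cabsD (dpoly nu_hat 1 (3 ^ K) t) (dpoly nu_hat (3 ^ K) (3 ^ M) t); lra.
apply: (le_trans (dpoly_chebyshev p0 T0 _ (measurable_exceptional_set A T) sub)); first lra.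
rewrite lee_fin.
have qM0 : 0 < (q ^+ 2) ^+ M by rewrite !exprn_gt0//; lra.
have s1 : \sum_(3 ^ K <= n < 3 ^ M) cabs (nu_hat n : R[i]) ^+ 2 / n%:R <=
    C2 * (16 * C1 ^+ 2 * q ^+ 2 / y ^+ 2).
  apply: le_trans (hC2 K M (ltnW KM)) _; rewrite ler_pM2l//.
  rewrite exprVn -[leRHS]invrK lef_pV2 ?posrE ?invr_gt0 ?divr_gt0 ?mulr_gt0 ?exprn_gt0//; try lra.
  rewrite invf_div ler_pdivrMr ?mulr_gt0 ?exprn_gt0//; try lra.
  move: (ltW Ku); rewrite ler_pdivrMr; last lra.
  move=> h; have : y ^+ 2 <= (q ^+ K.+1 * (4 * C1)) ^+ 2.
    by rewrite lerXn2r ?nnegrE ?mulr_ge0 ?exprn_ge0//; lra.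
  have -> : (q ^+ K.+1 * (4 * C1)) ^+ 2 = (q ^+ 2) ^+ K * (16 * C1 ^+ 2 * q ^+ 2).
    have -> : (q ^+ K.+1 * (4 * C1)) ^+ 2 = (q ^+ K.+1) ^+ 2 * (16 * C1 ^+ 2) by ring.
    have -> : (q ^+ K.+1) ^+ 2 = (q ^+ 2) ^+ K.+1 by rewrite -!exprM mulnC.
    by rewrite exprS; move: (q ^+ 2) => z; ring.
  by [].
have s2 : \sum_(3 ^ K <= n < 3 ^ M) cabs (nu_hat n : R[i]) * inv_sqrt n <= C1 * q ^+ M.
  apply: le_trans (hC1 M); rewrite [leRHS](big_cat_nat p0 KM3)/= lerDr sumr_ge0// => i _.
  by rewrite mulr_ge0 ?cabs_ge0// ltW ?inv_sqrt_gt0.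
have s20 : 0 <= \sum_(3 ^ K <= n < 3 ^ M) cabs (nu_hat n : R[i]) * inv_sqrt n.
  by rewrite sumr_ge0// => i _; rewrite mulr_ge0 ?cabs_ge0// ltW ?inv_sqrt_gt0.
have s3 : \sum_(3 ^ K <= n < 3 ^ M) cabs (nu_hat n : R[i]) ^+ 2 <= Cv * (q ^+ 2) ^+ M.
  apply: le_trans (hCv M); rewrite [leRHS](big_cat_nat (leq0n _) KM3)/= lerDr sumr_ge0// => i _.
  by rewrite sqr_ge0.
have s30 : 0 <= \sum_(3 ^ K <= n < 3 ^ M) cabs (nu_hat n : R[i]) ^+ 2.
  by rewrite sumr_ge0// => i _; rewrite sqr_ge0.
have hH := @harmonic_sum_exp3 R M.
have hH0 : 0 <= harmonic_sum (3 ^ M) :> R by rewrite sumr_ge0.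
have off : 2 * (\sum_(3 ^ K <= n < 3 ^ M) cabs (nu_hat n : R[i]) * inv_sqrt n) ^+ 2
     + 4 * harmonic_sum (3 ^ M) * \sum_(3 ^ K <= n < 3 ^ M) cabs (nu_hat n : R[i]) ^+ 2
     <= D * C3 * (T / y ^+ 2).
  apply: (@le_trans _ _ (D * ((1 + M%:R) * (q ^+ 2) ^+ M))); last first.
    rewrite -mulrA ler_pM2l// mulrA ler_pdivlMr ?exprn_gt0//; exact: hC3.
  have M0 : 0 <= (M%:R : R) by [].
  apply: (@le_trans _ _ (2 * (C1 ^+ 2 * (q ^+ 2) ^+ M) + 4 * (2 * M%:R) * (Cv * (q ^+ 2) ^+ M))).
    apply: lerD.
      rewrite ler_pM2l//.
      apply: (@le_trans _ _ ((C1 * q ^+ M) ^+ 2)).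
        by rewrite lerXn2r ?nnegrE// (le_trans s20).
      by rewrite exprMn -!exprM mulnC.
    apply: ler_pM => //; first by rewrite mulr_ge0.
    by rewrite ler_pM2l.
  have h1 : 0 <= C1 ^+ 2 * M%:R * (q ^+ 2) ^+ M.
    by apply: mulr_ge0; [rewrite mulr_ge0 ?sqr_ge0|exact: ltW].
  have h2 : 0 <= Cv * (q ^+ 2) ^+ M by rewrite mulr_ge0 ?ltW.
  move: h1 h2; rewrite /D; move: ((q ^+ 2) ^+ M) (C1 ^+ 2) => Q c h1 h2; lra.
rewrite (_ : _ * (T / y ^+ 4) = ((m0 ^+ 4 + 4 * C4) / 4 * (T / y ^+ 2)) / (y / 2) ^+ 2); last first.
  by field; rewrite gt_eqF.
apply: ler_wpM2r; first by rewrite invr_ge0 sqr_ge0.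
apply: (@le_trans _ _ (C4 * (T / y ^+ 2))).
  rewrite -[leLHS]addrA /C4 [leRHS]mulrDl; apply: lerD => //.
  apply: le_trans (ler_wpM2l (ltW T0) s1) _.
  by rewrite le_eqVlt; apply/orP; left; apply/eqP; ring.
apply: ler_wpM2r; first by rewrite divr_ge0 ?sqr_ge0 ?ltW.
have : 0 <= m0 ^+ 4 by rewrite exprn_ge0// ltW.
lra.
Qed.

End exceptional_bound.

(** * Logarithmic density *)
Section log_density.
Context {R : realType}.
Local Notation mu := (@lebesgue_measure R).
Local Notation L := (@nu_zeta R).

Definition large_values (A : R) : set (measurableTypeR R) :=
  [set t | 1 < t /\ ln t `^ A < nu_zeta_half t].

Lemma measurable_large_values_gt1 A : measurable (large_values A).
Proof.
rewrite (_ : large_values A = `]1, +oo[%classic `&` [set t | ln t `^ A < nu_zeta_half t]).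
  by apply: measurableI => //; exact: measurable_large_values.
by apply/seteqP; split => t; rewrite /large_values /= in_itv/= andbT.
Qed.

Lemma measurable_inv_itv1 (E : set (measurableTypeR R)) : measurable E ->
  (forall t, E t -> 1 <= t) ->
  measurable_fun E (fun t : measurableTypeR R => (t^-1)%:E).
Proof.
move=> mE E1; apply/measurable_EFinP.
have h : {in E, (fun t : R => expR (- ln t)) =1 (fun t => t^-1)}.
  move=> t /set_mem/E1 t1; rewrite expRN lnK// posrE; lra.
apply: (eq_measurable_fun _ h).
apply: measurable_funTS; apply: (measurableT_comp (@measurable_expR R)).
by apply: measurable_funN; exact: measurable_ln.
Qed.

Lemma integral_inv_le (E : set (measurableTypeR R)) (T : R) : measurable E ->
  1 <= T -> (forall t, E t -> T <= t) ->
  (\int[mu]_(t in E) (t^-1)%:E <= (T^-1)%:E * mu E)%E.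
Proof.
move=> mE T1 ET; rewrite -integral_cst//.
apply: ge0_le_integral => //=.
- by move=> t /ET Tt; rewrite lee_fin invr_ge0; lra.
- by apply: measurable_inv_itv1 => // t /ET; lra.
- by move=> t /ET Tt; rewrite lee_fin lef_pV2 ?posrE; lra.
Qed.

(** Going from 2 ^ j to 2 ^ j.+1 adds at most 2 ^ (- j) times the measure of the
exceptional set at T = 2 ^ j, that is O(j ^ (- 4 A)), and 4 A >= 2. *)
Lemma large_values_log_integral (A : R) : 3 / 4 < A -> exists2 K : R, 0 < K &
  forall X : R,
    (\int[mu]_(t in large_values A `&` `[1%R, X]) (t^-1)%:E <= K%:E)%E.
Proof.
move=> A34; have A0 : 0 < A by lra.
have [C C0 hC] := exceptional_measure_le A0.
have l2 : 0 < ln (2 : R) by rewrite ln_gt0// ltr1n.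
pose c := C / ln 2 `^ (4 * A).
have c0 : 0 < c by rewrite divr_gt0// powR_gt0.
have mS X : measurable (large_values A `&` `[1, X] : set (measurableTypeR R)).
  by apply: measurableI => //; exact: measurable_large_values_gt1.
have ge1 X : forall t, (large_values A `&` `[1, X]) t -> 1 <= t.
  by move=> t [_]; rewrite /= in_itv/= => /andP[].
have dyadic n : (\int[mu]_(t in large_values A `&` `[1%R, (2 ^+ n.+1)%R]) (t^-1)%:E <=
    (1 + c * \sum_(0 <= i < n) (i.+1%:R ^+ 2)^-1)%:E)%E.
  elim: n => [|n IHn].
    rewrite big_nil mulr0 addr0 expr1.
    apply: le_trans (integral_inv_le (mS 2) (lexx 1) (@ge1 2)) _.
    rewrite invr1 mul1e.
    apply: (@le_trans _ _ (mu `[1%R, 2%R]%classic)).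
      by apply: le_measure; rewrite ?inE.
    rewrite lebesgue_measure_itv/= lte_fin ltr1n/= -EFinB lee_fin; lra.
  set a : R := 2 ^+ n.+1.
  have a0 : 0 < a by rewrite exprn_gt0.
  have a2 : 2 <= a by rewrite /a exprS ler_peMr// exprn_ege1// ler1n.
  have e2 : 2 ^+ n.+2 = 2 * a by rewrite exprS.
  rewrite e2.
  have -> : large_values A `&` `[1, 2 * a] =
      (large_values A `&` `[1, a]) `|` (large_values A `&` `]a, 2 * a]).
    rewrite -setIUr; congr (_ `&` _).
    by rewrite -itv_bndbnd_setU// bnd_simp; lra.
  have mB : measurable (large_values A `&` `]a, 2 * a] : set (measurableTypeR R)).
    by apply: measurableI => //; exact: measurable_large_values_gt1.
  have geB t : (large_values A `&` `]a, 2 * a]) t -> a <= t.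
    by move=> [_]; rewrite /= in_itv/= => /andP[/ltW].
  rewrite ge0_integral_setU//=; last 3 first.
  - by apply: measurable_inv_itv1 => [|t [/(@ge1 a)//|/geB]]; [exact: measurableU|lra].
  - by move=> t [/(@ge1 a) t1|/geB ta]; rewrite lee_fin invr_ge0; lra.
  - apply/disj_setPS => t [[_ h1] [_ h2]]; move: h1 h2; rewrite /= !in_itv/=; lra.
  have -> : 1 + c * \sum_(0 <= i < n.+1) (i.+1%:R ^+ 2)^-1 =
      (1 + c * \sum_(0 <= i < n) (i.+1%:R ^+ 2)^-1) + c * (n.+1%:R ^+ 2)^-1.
    by rewrite big_nat_recr//= mulrDr addrA.
  rewrite EFinD; apply: leeD => //.
  apply: le_trans (integral_inv_le mB _ geB) _; first lra.
  apply: (@le_trans _ _ ((a^-1)%:E * (C * (a / ln a `^ (4 * A)))%:E)%E).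
    apply: lee_wpmul2l; first by rewrite lee_fin invr_ge0 ltW.
    apply: le_trans (hC a a2); apply: le_measure; rewrite ?inE//.
      exact: measurable_exceptional_set.
    move=> t [[t1 ht]]; rewrite /= in_itv/= => ta.
    by split => //; lra.
  rewrite -EFinM lee_fin.
  have -> : a^-1 * (C * (a / ln a `^ (4 * A))) = C / ln a `^ (4 * A).
    by field; rewrite !gt_eqF ?powR_gt0// ln_gt0//; lra.
  have n0 : 1 <= n.+1%:R :> R by rewrite ler1n.
  rewrite /a lnXn// -[ln 2 *+ _]mulr_natl powRM//; last exact: ltW.
  rewrite invfM [_^-1 * _]mulrC mulrA -/c.
  apply: ler_wpM2l; first by rewrite ltW.
  rewrite lef_pV2 ?posrE ?powR_gt0 ?exprn_gt0//.
  rewrite -powR_mulrn; last lra.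
  by apply: ler_powR => //; lra.
exists (1 + 2 * c) => [|X]; first lra.
have [n hn] : exists n : nat, X <= 2 ^+ n.+1.
  exists (Num.truncn `|X|); apply: le_trans (ler_norm X) _.
  apply: ltW; apply: lt_le_trans (truncnS_gt `|X|) _.
  by rewrite -natrX ler_nat ltnW// ltn_expl.
apply: (@le_trans _ _ (\int[mu]_(t in large_values A `&` `[1%R, (2 ^+ n.+1)%R]) (t^-1)%:E)%E).
  apply: ge0_subset_integral => //=.
  - by apply: measurable_inv_itv1 => // t /(@ge1 (2 ^+ n.+1)).
  - by move=> t /(@ge1 (2 ^+ n.+1)) t1; rewrite lee_fin invr_ge0; lra.
  - apply: setIS => t; rewrite /= !in_itv/= => /andP[-> tX]; exact: le_trans tX hn.
apply: le_trans (dyadic n) _; rewrite lee_fin lerD2l mulrC.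
by apply: ler_wpM2r; [exact: ltW|exact: sum_inv_sqr_le].
Qed.

Lemma large_values_log_density (A : R) : 3 / 4 < A ->
  has_log_density (large_values A) (0 : R).
Proof.
move=> A34; split; first exact: measurable_large_values_gt1.
have [K K0 hK] := large_values_log_integral A34.
apply/cvgrPdist_le => e e0.
near=> X.
have X1 : 1 < X by near: X; exact: nbhs_pinfty_gt.
have lX : 0 < ln X by exact: ln_gt0.
have eX : expR (K / e) <= X by near: X; exact: nbhs_pinfty_ge.
rewrite sub0r normrN /Rintegral.
set I := (\int[_]_(_ in _) _)%E.
have I0 : (0 <= I)%E.
  apply: integral_ge0 => t [_]; rewrite /= in_itv/= => /andP[t1 _].
  by rewrite lee_fin invr_ge0; lra.
have IK : (I <= K%:E)%E by exact: hK.
have If : I \is a fin_num by rewrite ge0_fin_numE// (le_lt_trans IK)// ltry.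
rewrite ger0_norm ?divr_ge0 ?fine_ge0// ?(ltW lX)//.
rewrite ler_pdivrMr//.
apply: (@le_trans _ _ K); first by rewrite -lee_fin fineK.
rewrite -ler_pdivrMl// mulrC -[leLHS]expRK ler_ln ?posrE ?expR_gt0//; lra.
Unshelve. all: by end_near. Qed.

End log_density.

Theorem corollary9p36 (R : realType) :
  exists L : R[i] -> R[i],
    [/\ entire_continuation nu_hat L,
        forall A : R, 0 < A ->
          exists C : R, 0 < C /\
            forall T : R, 2 <= T ->
              (lebesgue_measure (exceptional_set L A T)
                 <= (C * (T / ln T `^ (4 * A - 3)))%:E)%E
      & forall A : R, 3 / 4 < A ->
          exists S : set R, has_log_density S 0 /\
            forall t : R, 1 < t -> ~ S t ->
              cabs (L ((1 / 2) +i* t)%C) <= ln t `^ A].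
Proof.
exists (@nu_zeta R); split; first exact: nu_zeta_continuation.
  move=> A A0; have [C C0 hC] := exceptional_measure_le A0.
  have l2 : 0 < ln (2 : R) by rewrite ln_gt0// ltr1n.
  exists (C / ln 2 ^+ 3); split=> [|T T2]; first by rewrite divr_gt0// exprn_gt0.
  apply: le_trans (hC T T2) _; rewrite lee_fin.
  have l0 : ln 2 <= ln T by rewrite ler_ln ?posrE; lra.
  have lT : 0 < ln T by lra.
  have p0 : 0 < ln T `^ (4 * A - 3) by exact: powR_gt0.
  have e : ln T `^ (4 * A) = ln T `^ (4 * A - 3) * ln T ^+ 3.
    rewrite -powR_mulrn ?(ltW lT)// -powRD; last by rewrite (gt_eqF lT) implybT.
    by congr (_ `^ _); ring.
  rewrite e; set u := ln T `^ (4 * A - 3) in p0 *.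
  have v0 : 0 < ln T ^+ 3 by rewrite exprn_gt0.
  have w0 : 0 < ln (2 : R) ^+ 3 by rewrite exprn_gt0.
  have wv : ln (2 : R) ^+ 3 <= ln T ^+ 3 by rewrite lerXn2r ?nnegrE// ltW.
  rewrite (_ : C * (T / (u * ln T ^+ 3)) = C * (T / u) * (ln T ^+ 3)^-1); last first.
    by field; rewrite !gt_eqF.
  rewrite (_ : C / ln 2 ^+ 3 * (T / u) = C * (T / u) * (ln 2 ^+ 3)^-1); last by ring.
  apply: ler_wpM2l; first by rewrite mulr_ge0 ?divr_ge0 ?ltW//; lra.
  by rewrite lef_pV2.
move=> A A34; exists (large_values A); split; first exact: large_values_log_density.
move=> t t1 nS; rewrite leNgt; apply/negP => h; apply: nS; split => //.
Qed.
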